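(* Let $\mathsf{LP}$ be the symmetric two-coloured operad (colours $A$, $L$) of Leibniz pairs, generated by a skew-symmetric operation $\beta:L\otimes L\to L$, an operation $a:A\otimes A\to A$ (no symmetry) and an operation $d:L\otimes A\to A$ (no symmetry), subject to the relations $$\beta(\beta(x_1,x_2),x_3)-\beta(\beta(x_1,x_3),x_2)-\beta(x_1,\beta(x_2,x_3))=0,$$ $$a(a(x_1,x_2),x_3)-a(x_1,a(x_2,x_3))=0,$$ $$d(x_1,a(x_2,x_3))-a(x_2,d(x_1,x_3))-a(d(x_1,x_2),x_3)=0,$$ $$d(\beta(x_1,x_2),x_3)-d(x_1,d(x_2,x_3))+d(x_2,d(x_1,x_3))=0.$$ Then the defining relations of $\mathsf{LP}$ (with all their symmetric group orbits) form a quadratic Gröbner basis of the ideal of relations of the associated shuffle operad, with generators $\beta,a,b,d,e$, where $b(x_1,x_2)=a(x_2,x_1)$ and $e(x_1,x_2)=d(x_2,x_1)$, with respect to the QM (partial) ordering in which $a,b$ are variables of type $x$, while $\beta,d,e$ are variables of type $y$, and in addition $a>b$, $d>e$ lexicographically.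
   Context: Work over a field $\Bbbk$ of characteristic $0$. Let $I$ be a finite set of colours. A symmetric $I$-coloured operad $P$ consists of finite-dimensional spaces $P(n,\chi,c)$ for $n\ge 1$, $\chi:\{1,\dots,n\}\to I$ (input colours), $c\in I$ (output colour), with symmetric group actions $\sigma:P(n,\chi,c)\to P(n,\chi\sigma,c)$, partial compositions $\circ_l$ defined when the colour of the $l$-th input equals the output colour of the inserted operation, and identities $\mathrm{id}_c$, satisfying the usual operad axioms. Free shuffle coloured operad. Given generators, each with an arity, an ordered list of input colours and an output colour, the free shuffle $I$-coloured operad has as basis the tree monomials: planar rooted trees with vertices labelled by generators, edge colours matching the input/output colours of the generators, and leaves labelled bijectively by $1,\dots,n$ so that at every vertex the smallest leaf labels of the subtrees above its inputs increase from left to right. Shuffle compositions $\alpha\circ_{l,\omega}\gamma$ graft $\gamma$ on the leaf $l$ of $\alpha$ (colours matching) and relabel the leaves by $\omega$, preserving the relative orders of labels coming from $\alpha$ and from $\gamma$, so that the result is again a shuffle tree. An operadic ideal is a collection of subspaces, one for each arity, input colouring and output colour, closed under compositions with arbitrary elements on either side. A symmetric operad given by generators and relations yields a shuffle operad: its generators are all generators together with a basis of their symmetric group orbits, and its relations are all elements of the symmetric group orbits of the relations, rewritten as combinations of shuffle tree monomials. An ordering of tree monomials is admissible if monomials of smaller arity are smaller and $\alpha\le\alpha'$, $\gamma\le\gamma'$ (with $\alpha,\alpha'$ of the same arity and $\gamma,\gamma'$ of the same arity) imply $\alpha\circ_{l,\omega}\gamma\le\alpha'\circ_{l,\omega}\gamma'$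 for all possible compositions. QM-ordering: each generator is declared to be of type $x$ or of type $y$. Impose the rule $uv=vuq$ whenever $u$ is a letter of type $y$ and $v$ a letter of type $x$, with $q$ central; each word in the generators then has a normal form (word in letters of type $x$)(word in letters of type $y$)$\,q^{d_q}$, with the two words of lengths $d_x$ and $d_y$. To compare two words: the one with greater $d_x$ is smaller; if equal, compare the words in letters of type $x$ lexicographically (here with $a>b$); if equal, the one with greater $d_y$ is greater; if equal, compare the words in letters of type $y$ lexicographically (here with $d>e$; the place of $\beta$ is arbitrary); if equal, the one with greater $d_q$ is greater. To compare tree monomials, compare arities first (smaller arity is smaller); for equal arity $k$ compare the vectors $(a_1,\dots,a_k)$, where $a_j$ is the word of vertex labels on the path from the root to leaf $j$, component by component using this comparison of words. This is a partial ordering; any extension of it to an admissible total ordering may be used. Gröbner bases: the leading term of an element is its largest tree monomial. For a subtree (containing all edges adjacent to its vertices) of a tree monomial, its leaves are relabelled according to the order of the smallest leaf labels above them; $\alpha$ is divisible by $\gamma$ if $\gamma$ arises in this way from a subtree of $\alpha$. A generating set $G$ of an operadic ideal $M$ is a Gröbner basis if the leading term of every nonzero $f\in M$ is divisible by the leading term of some element of $G$. It is quadratic if all its elements are combinations of tree monomials with two vertices. *)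

(* Defs.v *)
From HB Require Import structures.
From mathcomp Require Import all_boot all_order all_algebra.
From mathcomp Require Import finmap monalg.

Set Implicit Arguments.
Unset Strict Implicit.
Unset Printing Implicit Defensive.

Import GRing.Theory.

(* Only operads generated by binary operations are needed, so trees are binary:
   a generator g has input colours (src1 g, src2 g) and output colour tgt g. *)
Record signature := Signature {
  colour : finType;
  gen : finType;
  src1 : gen -> colour;
  src2 : gen -> colour;
  tgt : gen -> colour
}.

(* The colour of a leaf is recorded so that the trivial trees (the identities
   of the various colours) are distinct.  Planar trees that are not shuffle
   trees are also used, for the symmetric operad. *)
Inductive tree (S : signature) :=
| Leaf of colour S & nat
| Node of gen S & tree S & tree S.

Section TreeCountable.
Variable S : signature.

Fixpoint tree_code (t : tree S) : GenTree.tree (colour S * nat + gen S) :=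
  match t with
  | Leaf c j => GenTree.Leaf (inl (c, j))
  | Node g s u =>
      GenTree.Node 0 [:: GenTree.Leaf (inr g); tree_code s; tree_code u]
  end.

Fixpoint tree_decode (x : GenTree.tree (colour S * nat + gen S)) :
    option (tree S) :=
  match x with
  | GenTree.Leaf (inl (c, j)) => Some (Leaf c j)
  | GenTree.Node _ [:: GenTree.Leaf (inr g); y; z] =>
      if (tree_decode y, tree_decode z) is (Some s, Some u)
      then Some (Node g s u) else None
  | _ => None
  end.

Lemma tree_codeK : pcancel tree_code tree_decode.
Proof. by elim=> [c j|g s IHs u IHu] //=; rewrite IHs IHu. Qed.

HB.instance Definition _ := Countable.copy (tree S) (pcan_type tree_codeK).

End TreeCountable.

Section ShuffleTrees.
Variable S : signature.
Implicit Types (s t u : tree S).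

Definition out t : colour S :=
  match t with Leaf c _ => c | Node g _ _ => tgt g end.

Fixpoint leaves t : seq (nat * colour S) :=
  match t with Leaf c j => [:: (j, c)] | Node _ s u => leaves s ++ leaves u end.

Definition labels t : seq nat := unzip1 (leaves t).

Definition arity t : nat := size (leaves t).

Fixpoint min_label t : nat :=
  match t with Leaf _ j => j | Node _ s u => minn (min_label s) (min_label u) end.

Fixpoint vertices t : nat :=
  match t with Leaf _ _ => 0 | Node _ s u => (vertices s + vertices u).+1 end.

Fixpoint well_coloured t : bool :=
  match t with
  | Leaf _ _ => true
  | Node g s u => [&& out s == src1 g, out u == src2 g,
                      well_coloured s & well_coloured u]
  end.

Fixpoint increasing t : bool :=
  match t with
  | Leaf _ _ => true
  | Node _ s u => [&& (min_label s < min_label u), increasing s & increasing u]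
  end.

Definition tree_monomial t : bool :=
  [&& well_coloured t, increasing t & perm_eq (labels t) (iota 1 (arity t))].

(* chi lists the input colours: the leaf labelled j has colour number j.-1. *)
Definition typed (chi : seq (colour S)) (c : colour S) : pred (tree S) :=
  fun t => [&& tree_monomial t, arity t == size chi, out t == c &
               all (fun p => onth chi p.1.-1 == Some p.2) (leaves t)].

Fixpoint relabel (f : nat -> nat) t : tree S :=
  match t with
  | Leaf c j => Leaf c (f j)
  | Node g s u => Node g (relabel f s) (relabel f u)
  end.

Fixpoint substitute t (l : nat) (r : tree S) : tree S :=
  match t with
  | Leaf c j => if j == l then r else Leaf c j
  | Node g s u => Node g (substitute s l r) (substitute u l r)
  end.

(* omega permutes {1, ..., n} *)
Definition permutes (n : nat) (omega : nat -> nat) : bool :=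
  perm_eq [seq omega j | j <- iota 1 n] (iota 1 n).

(* Before omega is applied, the labels of the grafted tree (of arity n) are
   l, ..., l + n - 1, and those of the tree of arity m it is grafted on are
   1, ..., l - 1, l + n, ..., m + n - 1.  The smallest label l of the grafted
   tree keeps the place of the leaf l among the latter, which is what makes the
   result a shuffle tree for all trees of arities m and n (so that the
   composition is defined on linear combinations); consequently omega fixes
   1, ..., l. *)
Definition shuffles (m n l : nat) (omega : nat -> nat) : bool :=
  [&& (1 <= l <= m), permutes (m + n).-1 omega,
      sorted ltn [seq omega j | j <- iota 1 l ++ iota (l + n) (m - l)] &
      sorted ltn [seq omega j | j <- iota l n]].

Definition compose (l : nat) (omega : nat -> nat) t u : tree S :=
  let n := arity u in
  let t' := relabel (fun j => if (j <= l) then j else (j + n.-1)) t in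
  let u' := relabel (fun j => (j + l.-1)) u in
  relabel omega (substitute t' l u').

Definition composable (l : nat) (omega : nat -> nat) t u : bool :=
  ((l, out u) \in leaves t) && shuffles (arity t) (arity u) l omega.

(* subtrees containing a given root, every removed branch being replaced by a
   leaf labelled by the smallest label of that branch *)
Fixpoint prunings t : seq (tree S) :=
  Leaf (out t) (min_label t) ::
  match t with
  | Leaf _ _ => [::]
  | Node g s u => [seq Node g s' u' | s' <- prunings s, u' <- prunings u]
  end.

Fixpoint branches t : seq (tree S) :=
  t :: match t with
       | Leaf _ _ => [::]
       | Node _ s u => branches s ++ branches u
       end.

Definition standardize t : tree S :=
  relabel (fun j => (index j (sort leq (labels t))).+1) t.

Definition divides u t : bool :=
  has (fun s => u \in [seq standardize s' | s' <- prunings s]) (branches t).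

Record admissible_order (le : rel (tree S)) : Prop := AdmissibleOrder {
  adm_refl : {in tree_monomial, reflexive le};
  adm_anti : {in tree_monomial &, antisymmetric le};
  adm_trans : {in tree_monomial & &, transitive le};
  adm_total : {in tree_monomial &, total le};
  adm_arity : {in tree_monomial &, forall t t',
                 (arity t < arity t') -> le t t'};
  adm_compose : forall l omega (t t' u u' : tree S),
    tree_monomial t -> tree_monomial t' ->
    tree_monomial u -> tree_monomial u' ->
    arity t = arity t' -> arity u = arity u' ->
    composable l omega t u -> composable l omega t' u' ->
    le t t' -> le u u' -> le (compose l omega t u) (compose l omega t' u')
}.

End ShuffleTrees.

Section FreeShuffleOperad.
Local Open Scope ring_scope.
Variables (k : fieldType) (S : signature).
Implicit Types (f g : {malg k[tree S]}) (chi : seq (colour S)).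

Definition linext (S' : signature) (h : tree S -> {malg k[tree S']}) f :
    {malg k[tree S']} :=
  \sum_(t <- msupp f) f@_t *: h t.

(* f belongs to the component of the free shuffle operad with input colours chi
   and output colour c *)
Definition in_component chi (c : colour S) f : Prop :=
  {subset msupp f <= typed chi c}.

Definition mcompose (l : nat) (omega : nat -> nat) f g : {malg k[tree S]} :=
  linext (fun t => linext (fun u => << compose l omega t u >>) g) f.

(* A collection of subspaces, one in each component, is encoded by the predicate
   of belonging to one of them. *)
Record operadic_ideal (M : {malg k[tree S]} -> Prop) : Prop := OperadicIdeal {
  ideal_homogeneous : forall f, M f -> exists chi c, in_component chi c f;
  ideal0 : M 0;
  idealD : forall chi c f g,
    in_component chi c f -> in_component chi c g -> M f -> M g -> M (f + g);
  idealZ : forall (x : k) f, M f -> M (x *: f);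
  ideal_compose : forall l omega chi c chi' c' f g,
    in_component chi c f -> in_component chi' c' g ->
    onth chi l.-1 = Some c' -> shuffles (size chi) (size chi') l omega ->
    M f \/ M g -> M (mcompose l omega f g)
}.

Definition generated_ideal (G : {malg k[tree S]} -> Prop) f : Prop :=
  forall M, operadic_ideal M -> (forall g, G g -> M g) -> M f.

Definition leading_term (le : rel (tree S)) f (t : tree S) : Prop :=
  t \in msupp f /\ forall s, s \in msupp f -> le s t.

Definition groebner_basis (le : rel (tree S)) (G M : {malg k[tree S]} -> Prop) :
    Prop :=
  [/\ operadic_ideal M,
      forall f, M f <-> generated_ideal G f &
      forall f, M f -> f != 0 ->
        exists t g u, [/\ leading_term le f t, G g, leading_term le g u &
                          divides u t]].

Definition quadratic (G : {malg k[tree S]} -> Prop) : Prop :=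
  forall g t, G g -> t \in msupp g -> vertices t = 2%N.

End FreeShuffleOperad.

Section QMOrdering.
Variables (S : signature) (is_x : pred (gen S)).
(* rk gives the order of the letters of each type: u < v when rk u < rk v *)
Variable rk : gen S -> nat.
Implicit Types (w : seq (gen S)) (t : tree S).

(* (X, Y, d) stands for the normal form X Y q^d; a letter of type y multiplied
   on the left of it is moved past X by the rule u v = v u q. *)
Fixpoint qm_normal_form w : seq (gen S) * seq (gen S) * nat :=
  if w is u :: w' then
    let: (X, Y, d) := qm_normal_form w' in
    if is_x u then (u :: X, Y, d) else (X, u :: Y, (size X + d))
  else ([::], [::], 0).

Definition lex_lt (w w' : seq (gen S)) : bool :=
  (([seq rk u | u <- w] : seqlexi nat) < [seq rk u | u <- w'])%O.

Definition qm_word_lt w w' : Prop :=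
  let: (X, Y, d) := qm_normal_form w in
  let: (X', Y', d') := qm_normal_form w' in
  (size X' < size X) \/ size X = size X' /\
  (lex_lt X X' \/ X = X' /\
  ((size Y < size Y') \/ size Y = size Y' /\
  (lex_lt Y Y' \/ Y = Y' /\ (d < d')))).

(* vertex labels on the path from the root to the leaf labelled j *)
Fixpoint path_word (j : nat) t : seq (gen S) :=
  match t with
  | Leaf _ _ => [::]
  | Node g s u => g :: path_word j (if j \in labels s then s else u)
  end.

Definition qm_lt t t' : Prop :=
  (arity t < arity t') \/ arity t = arity t' /\
  exists j, [/\ (1 <= j <= arity t),
    forall i, (1 <= i < j) ->
      qm_normal_form (path_word i t) = qm_normal_form (path_word i t') &
    qm_word_lt (path_word j t) (path_word j t')].

Definition extends_qm (le : rel (tree S)) : Prop :=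
  {in @tree_monomial S &, forall t t', qm_lt t t' -> le t t'}.

End QMOrdering.

Variant lp_colour := colA | colL.
Variant sym_gen := SBeta | Sa | Sd.
Variant lp_gen := Beta | Ga | Gb | Gd | Ge.

Definition lp_colour_code (c : lp_colour) : bool :=
  if c is colA then true else false.
Definition lp_colour_decode (x : bool) : lp_colour := if x then colA else colL.
Lemma lp_colour_codeK : cancel lp_colour_code lp_colour_decode.
Proof. by case. Qed.
HB.instance Definition _ := Finite.copy lp_colour (can_type lp_colour_codeK).

Definition sym_gen_code (g : sym_gen) : option bool :=
  match g with SBeta => None | Sa => Some true | Sd => Some false end.
Definition sym_gen_decode (x : option bool) : sym_gen :=
  match x with None => SBeta | Some true => Sa | Some false => Sd end.
Lemma sym_gen_codeK : cancel sym_gen_code sym_gen_decode.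
Proof. by case. Qed.
HB.instance Definition _ := Finite.copy sym_gen (can_type sym_gen_codeK).

Definition lp_gen_code (g : lp_gen) : option (bool * bool) :=
  match g with
  | Beta => None
  | Ga => Some (true, true) | Gb => Some (true, false)
  | Gd => Some (false, true) | Ge => Some (false, false)
  end.
Definition lp_gen_decode (x : option (bool * bool)) : lp_gen :=
  match x with
  | None => Beta
  | Some (true, true) => Ga | Some (true, false) => Gb
  | Some (false, true) => Gd | Some (false, false) => Ge
  end.
Lemma lp_gen_codeK : cancel lp_gen_code lp_gen_decode.
Proof. by case. Qed.
HB.instance Definition _ := Finite.copy lp_gen (can_type lp_gen_codeK).

(* generators of the symmetric operad LP *)
Definition sym_sig : signature := {|
  colour := lp_colour;
  gen := sym_gen;
  src1 := fun g => match g with Sa => colA | SBeta | Sd => colL end;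
  src2 := fun g => match g with Sa | Sd => colA | SBeta => colL end;
  tgt := fun g => match g with Sa | Sd => colA | SBeta => colL end
|}.

(* generators of the associated shuffle operad *)
Definition lp_sig : signature := {|
  colour := lp_colour;
  gen := lp_gen;
  src1 := fun g => match g with Ga | Gb | Ge => colA | Beta | Gd => colL end;
  src2 := fun g => match g with Ga | Gb | Gd => colA | Beta | Ge => colL end;
  tgt := fun g => match g with Beta => colL | Ga | Gb | Gd | Ge => colA end
|}.

(* A planar tree in the generators of LP, with arbitrarily permuted labels, is up
   to a sign a shuffle tree: beta(x, y) = - beta(y, x), a(x, y) = b(y, x),
   d(x, y) = e(y, x).  The boolean is true when the sign is -1. *)
Definition same_gen (g : sym_gen) : lp_gen :=
  match g with SBeta => Beta | Sa => Ga | Sd => Gd end.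
Definition opposite_gen (g : sym_gen) : bool * lp_gen :=
  match g with
  | SBeta => (true, Beta) | Sa => (false, Gb) | Sd => (false, Ge)
  end.

Fixpoint shuffle_form (t : tree sym_sig) : bool * tree lp_sig :=
  match t with
  | Leaf c j => (false, @Leaf lp_sig c j)
  | Node g s u =>
      let: (e, s') := shuffle_form s in
      let: (e', u') := shuffle_form u in
      if (min_label s < min_label u)
      then (e (+) e', @Node lp_sig (same_gen g) s' u')
      else let: (e0, g') := opposite_gen g in
           (e0 (+) (e (+) e'), @Node lp_sig g' u' s')
  end.

Section LeibnizPairs.
Local Open Scope ring_scope.
Variable k : fieldType.

Definition to_shuffle : {malg k[tree sym_sig]} -> {malg k[tree lp_sig]} :=
  linext (fun t => (-1) ^+ (shuffle_form t).1 *: << (shuffle_form t).2 >>).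

Definition act (sigma : nat -> nat) :
    {malg k[tree sym_sig]} -> {malg k[tree sym_sig]} :=
  linext (fun t => << relabel sigma t >>).

Local Notation beta := (@Node sym_sig SBeta).
Local Notation a := (@Node sym_sig Sa).
Local Notation d := (@Node sym_sig Sd).
Local Notation A j := (@Leaf sym_sig colA j%N).
Local Notation L j := (@Leaf sym_sig colL j%N).

Definition lp_relations : seq {malg k[tree sym_sig]} :=
  [:: << beta (beta (L 1) (L 2)) (L 3) >> - << beta (beta (L 1) (L 3)) (L 2) >>
        - << beta (L 1) (beta (L 2) (L 3)) >>;
      << a (a (A 1) (A 2)) (A 3) >> - << a (A 1) (a (A 2) (A 3)) >>;
      << d (L 1) (a (A 2) (A 3)) >> - << a (A 2) (d (L 1) (A 3)) >>
        - << a (d (L 1) (A 2)) (A 3) >>;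
      << d (beta (L 1) (L 2)) (A 3) >> - << d (L 1) (d (L 2) (A 3)) >>
        + << d (L 2) (d (L 1) (A 3)) >>].

Definition lp_shuffle_relations (f : {malg k[tree lp_sig]}) : Prop :=
  exists r sigma,
    [/\ r \in lp_relations, permutes 3 sigma & f = to_shuffle (act sigma r)].

Definition lp_ideal : {malg k[tree lp_sig]} -> Prop :=
  generated_ideal lp_shuffle_relations.

End LeibnizPairs.

Definition lp_is_x : pred (gen lp_sig) :=
  fun g => match g with Ga | Gb => true | Beta | Gd | Ge => false end.

(* Main.v *)
(** Both [beta] and [d] are sent to the commutator and [a] to the product of a
free associative algebra; substituting generic letters for the leaves evaluates
every shuffle tree there, and the elements that evaluate to zero under all
substitutions form an operadic ideal containing the relations.  Call a tree
normal when no leading term of a relation divides it.  A tree that is not normal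
evaluates like a combination of smaller trees, hence like a combination of
smaller normal trees.  Evaluations of normal trees are linearly independent:
with the letters of colour A below those of colour L, the lexicographically
smallest word of the evaluation of a shuffle tree has coefficient 1 or -1, and a
normal tree can be read off from it.  Hence the leading term of a nonzero
element of the ideal is never normal. *)

From HB Require Import structures.
Require Import Defs.
From mathcomp Require Import all_boot all_order all_algebra.
From mathcomp Require Import finmap monalg zify.

Set Implicit Arguments.
Unset Strict Implicit.
Unset Printing Implicit Defensive.

Import Order.TTheory GRing.Theory.
Local Open Scope ring_scope.

(** No confluence check is made: independence of normal trees under a map that kills the ideal does
    its work, so reductions have to hold only after evaluation. The obstacle is that [le] is an
    arbitrary admissible extension of a partial order. Comparisons therefore go through [word_ltb]
    and [lower], which use the prescribed inequalities alone and survive grafting into a context,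
    and termination comes from the finiteness of each component. Letters of colour A are placed
    below those of colour L so that the lowest word of an iterated action on one A letter begins
    with that letter. A word of colour A is then cut into blocks at its A letters, and this cut
    makes decoding possible. The relations are finitely many signed lists of trees, so their types
    and leading terms are verified by computation. *)

Lemma rem_cat (T : eqType) (x : T) s u :
  rem x (s ++ u) = if x \in s then rem x s ++ u else s ++ rem x u.
Proof.
elim: s => [|y s IHs] //=; rewrite inE eq_sym; case: eqP => //= _.
by rewrite IHs; case: ifP.
Qed.

Lemma uniq_map_inj (T T' : eqType) (f : T -> T') (s : seq T) :
  uniq (map f s) -> {in s &, injective f}.
Proof.
elim: s => [|x s IHs] //= /andP[xs us] y z; rewrite !inE.
case/orP=> [/eqP->|ys] /orP[/eqP->|zs] // E; last exact: IHs.
- by rewrite E map_f in xs.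
- by rewrite -E map_f in xs.
Qed.

Section LinearExtension.
Variables (k : fieldType) (K : choiceType) (V : lmodType k) (h : K -> V).
Implicit Types f g : {malg k[K]}.

(** The body is that of [linext] with values in an arbitrary module, so that one proof of linearity
    covers both composition of trees and evaluation in an algebra. *)
Definition mlin f : V := \sum_(t <- msupp f) f@_t *: h t.

Lemma mlinEw (d : {fset K}) f : (msupp f `<=` d)%fset ->
  mlin f = \sum_(t <- d) f@_t *: h t.
Proof.
move=> sfd; rewrite /mlin (big_fset_incl _ sfd) // => t _ /mcoeff_outdom ->.
by rewrite scale0r.
Qed.

Lemma mlin_is_linear : linear mlin.
Proof.
move=> c f g; pose d := (msupp f `|` msupp g)%fset.
have sf : (msupp f `<=` d)%fset by apply: fsubsetUl.
have sg : (msupp g `<=` d)%fset by apply: fsubsetUr.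
have sfg : (msupp (c *: f + g) `<=` d)%fset.
  apply: (fsubset_trans (msuppD_le _ _)).
  by apply: fsetSU; apply: msuppZ_le.
rewrite (mlinEw sf) (mlinEw sg) (mlinEw sfg) scaler_sumr -big_split /=.
by apply: eq_bigr => t _; rewrite mcoeffD mcoeffZ scalerDl scalerA.
Qed.

HB.instance Definition _ :=
  GRing.isLinear.Build k {malg k[K]} V _ mlin mlin_is_linear.

Lemma mlinU t : mlin << t >> = h t.
Proof.
rewrite (mlinEw msuppU_le) big_seq_fset1.
by rewrite mcoeffUU scale1r.
Qed.

End LinearExtension.

Lemma malg_scalerAr (K : monomType) (k : fieldType) (c : k)
  (f g : {malg k[K]}) : c *: (f * g) = f * (c *: g).
Proof.
apply/malgP=> x; rewrite mcoeffZ.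
have sub: (msupp (c *: g) `<=` msupp g)%fset by apply: msuppZ_le.
rewrite (mcoeffMlw _ (fsubset_refl _) (fsubset_refl _)).
rewrite (mcoeffMlw _ (fsubset_refl _) sub).
rewrite mulr_sumr; apply: eq_bigr => a _; rewrite mulr_sumr.
by apply: eq_bigr => b _; rewrite mcoeffZ -mulrnAr mulrCA mulrnAr mulrnAr.
Qed.

Definition free_algebra (k : fieldType) (I : choiceType) : algType k :=
  HB.pack_for (algType k) {malg k[{fmonom I}]}
    (GRing.Lalgebra_isAlgebra.Build k {malg k[{fmonom I}]}
       (@malg_scalerAr {fmonom I} k)).

(** * Labels, relabelling and substitution in trees *)

Section Trees.
Variable S : signature.
Implicit Types (s t u : tree S) (chi : seq (colour S)).

Lemma labels_node (g : gen S) s u : labels (Node g s u) = labels s ++ labels u.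
Proof. by rewrite /labels /unzip1 /= map_cat. Qed.

Lemma size_labels t : size (labels t) = arity t.
Proof. by rewrite size_map. Qed.

Lemma min_label_in t : min_label t \in labels t.
Proof.
elim: t => [c j|g s IHs u IHu]; first by rewrite /= inE.
rewrite labels_node mem_cat /= /minn; case: ifP => _; first by rewrite IHs.
by rewrite IHu orbT.
Qed.

Lemma min_label_le t j : j \in labels t -> (min_label t <= j)%N.
Proof.
elim: t => [c i|g s IHs u IHu]; first by rewrite /= inE => /eqP ->.
rewrite labels_node mem_cat /= geq_min => /orP[/IHs->//|/IHu->].
by rewrite orbT.
Qed.

Lemma min_label_eq t i : i \in labels t ->
  (forall j, j \in labels t -> (i <= j)%N) -> min_label t = i.
Proof.
move=> it imin; apply/eqP.
by rewrite eqn_leq min_label_le //= imin ?min_label_in.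
Qed.

Lemma labels_relabel f t : labels (relabel f t) = map f (labels t).
Proof.
elim: t => [c j|g s IHs u IHu] //=.
by rewrite !labels_node map_cat IHs IHu.
Qed.

Lemma leaves_relabel f t :
  leaves (relabel f t) = [seq (f p.1, p.2) | p <- leaves t].
Proof. by elim: t => [c j|g s IHs u IHu] //=; rewrite map_cat IHs IHu. Qed.

Lemma out_relabel f t : out (relabel f t) = out t.
Proof. by case: t. Qed.

Lemma well_coloured_relabel f t :
  well_coloured (relabel f t) = well_coloured t.
Proof. by elim: t => //= g s -> u ->; rewrite !out_relabel. Qed.

Lemma eq_relabel f f' t : {in labels t, f =1 f'} -> relabel f t = relabel f' t.
Proof.
elim: t => [c j|g s IHs u IHu] /= E; first by rewrite E // inE.
by rewrite IHs ?IHu // => j jt; apply: E; rewrite labels_node mem_cat jt ?orbT.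
Qed.

Lemma min_label_relabel f t :
  {in labels t &, {mono f : i j / (i <= j)%N}} ->
  min_label (relabel f t) = f (min_label t).
Proof.
move=> fmono; apply: min_label_eq.
  by rewrite labels_relabel map_f ?min_label_in.
rewrite labels_relabel => _ /mapP[j jt ->].
by rewrite fmono ?min_label_in ?min_label_le.
Qed.

Lemma increasing_relabel f t :
  {in labels t &, {mono f : i j / (i <= j)%N}} ->
  increasing (relabel f t) = increasing t.
Proof.
elim: t => [c j|g s IHs u IHu] //= fmono.
have fs : {in labels s &, {mono f : i j / (i <= j)%N}}.
  by move=> i j si sj; apply: fmono; rewrite labels_node mem_cat ?si ?sj.
have fu : {in labels u &, {mono f : i j / (i <= j)%N}}.
  by move=> i j si sj; apply: fmono; rewrite labels_node mem_cat ?si ?sj orbT.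
rewrite IHs // IHu // !min_label_relabel // !ltnNge fmono //.
  by rewrite labels_node mem_cat min_label_in orbT.
by rewrite labels_node mem_cat min_label_in.
Qed.

Definition standard_leaves chi := zip (iota 1 (size chi)) chi.

Lemma size_standard_leaves chi : size (standard_leaves chi) = size chi.
Proof. by rewrite size_zip size_iota minnn. Qed.

Lemma unzip1_standard_leaves chi :
  unzip1 (standard_leaves chi) = iota 1 (size chi).
Proof. by rewrite unzip1_zip // size_iota. Qed.

Lemma mem_standard_leaves chi p :
  (p \in standard_leaves chi) = (0 < p.1)%N && (onth chi p.1.-1 == Some p.2).
Proof.
case: p => j c /=; apply/idP/idP.
  case/(nthP (0%N, c)) => i; rewrite size_standard_leaves => lti.
  rewrite nth_zip ?size_iota // => -[<- E] /=.
  by rewrite nth_iota //= onthE (nth_map c) // E.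
case: j => [|j] //=; rewrite onthE => E.
have lt : (j < size chi)%N.
  by rewrite ltnNge -(size_map Some); apply/negP => ge; rewrite nth_default in E.
have {}E : nth c chi j = c by move: E; rewrite (nth_map c) // => /eqP[].
apply/(nthP (0%N, c)); exists j; first by rewrite size_standard_leaves.
by rewrite nth_zip ?size_iota // nth_iota // add1n E.
Qed.

(** Label, arity and input colour conditions collapse into one permutation of leaves, a form that
    substitutions and rewriting steps transport easily. *)
Lemma typedE chi c t : typed chi c t =
  [&& well_coloured t, increasing t, out t == c &
      perm_eq (leaves t) (standard_leaves chi)].
Proof.
rewrite /typed /tree_monomial; case: (well_coloured t) => //=.
case: (increasing t) => //=; case: (out t == c); last by rewrite !andbF.
rewrite /=; apply/idP/idP => [/and3P[pt /eqP at_ /allP H]|pt].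
  have un : uniq (leaves t).
    by apply: (map_uniq (f := fst)); rewrite (perm_uniq pt) iota_uniq.
  apply: uniq_perm => //.
    apply: (map_uniq (f := fst)).
    by rewrite -/(unzip1 _) unzip1_standard_leaves iota_uniq.
  have [] // := @uniq_min_size _ (leaves t) (standard_leaves chi) un.
    move=> p pl; rewrite mem_standard_leaves H // andbT.
    have: p.1 \in labels t by apply: map_f.
    by rewrite (perm_mem pt) mem_iota => /andP[].
  by rewrite size_standard_leaves -at_.
have at_: arity t = size chi.
  by rewrite /arity (perm_size pt) size_standard_leaves.
apply/and3P; split.
- by rewrite at_ -unzip1_standard_leaves perm_map.
- by rewrite at_.
- apply/allP => p; rewrite (perm_mem pt) mem_standard_leaves.
  by case/andP.
Qed.

(** When the labels are exactly 1, ..., n, the colours read in the order of the labels form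
    [chi]. *)
Lemma standardizable (s : seq (nat * colour S)) :
  perm_eq (unzip1 s) (iota 1 (size s)) ->
  exists chi, perm_eq s (standard_leaves chi).
Proof.
move=> ps; have us : uniq (unzip1 s) by rewrite (perm_uniq ps) iota_uniq.
case: s => [|p0 s'] in ps us *; first by exists [::].
set s := p0 :: s' in ps us *.
pose f i := (nth p0 s (index i (unzip1 s))).2.
exists (map f (iota 1 (size s))).
rewrite /standard_leaves size_map size_iota.
have -> : zip (iota 1 (size s)) (map f (iota 1 (size s))) =
          map (fun i => (i, f i)) (iota 1 (size s)).
  by elim: (iota _ _) => //= a l ->.
have Es : s = map (fun i => (i, f i)) (unzip1 s).
  apply: (eq_from_nth (x0 := p0)); rewrite ?size_map // => i lti.
  rewrite (nth_map 0%N) ?size_map // /f index_uniq ?size_map //.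
  by rewrite (nth_map p0) // -surjective_pairing.
by rewrite {1}Es perm_map.
Qed.

Lemma substitute_notin t l (r : tree S) :
  l \notin labels t -> substitute t l r = t.
Proof.
elim: t => [c j|g s IHs u IHu].
  by rewrite /= inE eq_sym => /negbTE ->.
rewrite labels_node mem_cat negb_or => /andP[ls lu] /=.
by rewrite IHs ?IHu.
Qed.

(** The assumption [min_label r = l] keeps the shuffle condition: the vertices below see the same
    smallest label as before the grafting. Uniqueness of labels confines the change to one
    branch. *)
Lemma substitute_spec t l (r : tree S) :
  (l, out r) \in leaves t -> uniq (labels t) -> min_label r = l ->
  well_coloured t -> increasing t -> well_coloured r -> increasing r ->
  [/\ well_coloured (substitute t l r), increasing (substitute t l r),
      out (substitute t l r) = out t,
      min_label (substitute t l r) = min_label t &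
      perm_eq (leaves (substitute t l r))
        (rem (l, out r) (leaves t) ++ leaves r)].
Proof.
move=> + + rl + + wr ir.
elim: t => [c j|g s IHs u IHu].
  rewrite /= inE => /eqP[lj <-] _ _ _; rewrite -lj eqxx.
  by split=> //=; rewrite eqxx.
rewrite labels_node cat_uniq mem_cat => lt /and3P[us /hasPn dis uu] /=.
case/and4P=> /eqP os /eqP ou ws wu /and3P[lsu is_ iu].
case ls : ((l, out r) \in leaves s).
  have lnu : l \notin labels u.
    by apply/negP => /dis/negP; apply; apply: (map_f fst ls).
  have [w1 i1 o1 m1 p1] := IHs ls us ws is_.
  rewrite (substitute_notin _ lnu) w1 i1 o1 m1 os ou !eqxx wu iu lsu.
  split=> //; rewrite rem_cat ls -catA.
  rewrite (perm_trans (perm_cat p1 (perm_refl _))) //.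
  by rewrite -catA perm_cat2l perm_catC.
rewrite ls /= in lt.
have lns : l \notin labels s.
  by apply: dis; apply: (map_f fst lt).
have [w1 i1 o1 m1 p1] := IHu lt uu wu iu.
rewrite (substitute_notin _ lns) w1 i1 o1 m1 os ou !eqxx ws is_ lsu.
by split=> //; rewrite rem_cat ls -catA perm_cat2l.
Qed.

Lemma relabel_substitute f t l (r : tree S) :
  (forall j, j \in labels t -> f j = f l -> j = l) ->
  relabel f (substitute t l r) = substitute (relabel f t) (f l) (relabel f r).
Proof.
elim: t => [c j|g s IHs u IHu] /= H.
  case: eqP => [->|ne]; first by rewrite eqxx.
  case: eqP => // E; case: ne; apply: H => //; by rewrite inE.
by rewrite IHs ?IHu // => j jt; apply: H; rewrite labels_node mem_cat jt ?orbT.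
Qed.

Lemma relabel_comp f f' t : relabel f (relabel f' t) = relabel (f \o f') t.
Proof. by elim: t => //= g s -> u ->. Qed.

End Trees.

(** * Types of shuffle compositions *)

Section Composition.
Variable S : signature.
Implicit Types (s t u : tree S) (chi : seq (colour S)).

Definition outer_shift (l n j : nat) := (if j <= l then j else j + n.-1)%N.
Definition inner_shift (l j : nat) := (j + l.-1)%N.

Lemma typed_labels chi c t : typed chi c t ->
  labels t =i iota 1 (size chi) /\ uniq (labels t).
Proof.
rewrite typedE => /and4P[_ _ _ /(perm_map fst)].
rewrite -/(unzip1 _) -/(unzip1 _) unzip1_standard_leaves => pt.
by split; [apply: perm_mem | rewrite (perm_uniq pt) iota_uniq].
Qed.

Lemma typed_arity chi c t : typed chi c t -> arity t = size chi.
Proof. by case/and4P=> _ /eqP. Qed.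

Lemma sorted_map_iota_mono (f : nat -> nat) n :
  sorted ltn (map f (iota 1 n)) ->
  {in iota 1 n &, {mono f : i j / (i <= j)%N}}.
Proof.
move=> so.
have lt i j : (0 < i)%N -> (i < j)%N -> (j <= n)%N -> (f i < f j)%N.
  move=> i0 ij jn; move: (sorted_ltn_nth ltn_trans 0%N so).
  move=> /(_ i.-1 j.-1); rewrite !inE size_map size_iota.
  rewrite !(nth_map 0%N) ?size_iota ?nth_iota; try lia.
  have -> : (1 + i.-1 = i)%N by lia.
  have -> : (1 + j.-1 = j)%N by lia.
  by apply; lia.
move=> i j; rewrite !mem_iota => /andP[i0 ni] /andP[j0 nj].
case: (ltngtP i j) => [ij|ji|->]; last by rewrite leqnn.
  by rewrite ltnW // lt //; lia.
by rewrite leqNgt lt //; lia.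
Qed.

(** The two sortedness conditions of [shuffles] in the form used later: shifting and then applying
    [omega] preserves the order of the labels of either tree. *)
Lemma shuffles_mono m n l omega : (0 < n)%N -> shuffles m n l omega ->
  {in iota 1 m &, {mono (omega \o outer_shift l n) : i j / (i <= j)%N}} /\
  {in iota 1 n &, {mono (omega \o inner_shift l) : i j / (i <= j)%N}}.
Proof.
move=> n0 /and4P[/andP[l0 lm] _ so si]; split; apply: sorted_map_iota_mono.
  suff -> : [seq (omega \o outer_shift l n) j | j <- iota 1 m] =
    [seq omega j | j <- iota 1 l ++ iota (l + n) (m - l)] by [].
  have -> : m = (l + (m - l))%N by lia.
  rewrite iotaD !map_cat; congr (_ ++ _).
    by apply/eq_in_map => j; rewrite mem_iota /= /outer_shift => /andP[_];
      rewrite ltnS => ->.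
  have -> : (l + (m - l) - l = m - l)%N by lia.
  case: n n0 {so si} => // n _.
  rewrite (_ : l + n.+1 = n + (1 + l))%N; last by lia.
  rewrite (iotaDl n) -map_comp; apply/eq_in_map => j; rewrite mem_iota => H.
  by rewrite /= /outer_shift ifN; [congr (omega _)|]; lia.
suff -> : [seq (omega \o inner_shift l) j | j <- iota 1 n] =
  [seq omega j | j <- iota l n] by [].
have -> : iota l n = map (addn l.-1) (iota 1 n).
  by rewrite -iotaDl addn1 prednK.
rewrite -map_comp.
by apply: eq_map => j; rewrite /= /inner_shift addnC.
Qed.

(** The leaves of a composite, expressed by the types alone: hence all composites of elements of two
    given components lie in one component. *)
Definition composed_leaves l omega c' chi chi' : seq (nat * colour S) :=
  [seq ((omega \o outer_shift l (size chi')) p.1, p.2)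
     | p <- rem (l, c') (standard_leaves chi)]
  ++ [seq ((omega \o inner_shift l) p.1, p.2) | p <- standard_leaves chi'].

(** The final relabelling can be pushed inside because it is injective on the outer labels, so that
    no leaf of [t] other than [l] is sent to [omega l]. *)
Lemma compose_substitute l omega chi c chi' c' t u :
  typed chi c t -> typed chi' c' u -> shuffles (size chi) (size chi') l omega ->
  compose l omega t u =
  substitute (relabel (omega \o outer_shift l (size chi')) t) (omega l)
    (relabel (omega \o inner_shift l) u).
Proof.
move=> tt tu sh; rewrite /compose (typed_arity tu).
have [lt ut] := typed_labels tt; have n0 : (0 < size chi')%N.
  by rewrite -(typed_arity tu) -size_labels; case: u {tu} => //= g s u;
     rewrite labels_node size_cat; have := min_label_in s; case: (labels s).
have [fm _] := shuffles_mono n0 sh; case/and4P: sh => /andP[l0 lm] _ _ _.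
rewrite relabel_substitute ?relabel_comp // => i.
rewrite labels_relabel => /mapP[j jt ->{i}] E.
move: jt; rewrite lt => jt.
have E' : (omega \o outer_shift l (size chi')) j =
          (omega \o outer_shift l (size chi')) l.
  by rewrite /= E /outer_shift leqnn.
have il : l \in iota 1 (size chi) by rewrite mem_iota l0 /=; lia.
have jl : j = l.
  by apply/eqP; rewrite eqn_leq -(fm _ _ jt il) -(fm _ _ il jt) E' leqnn.
by rewrite jl /outer_shift leqnn.
Qed.

Lemma compose_typed l omega chi c chi' c' t u :
  typed chi c t -> typed chi' c' u -> onth chi l.-1 = Some c' ->
  shuffles (size chi) (size chi') l omega ->
  [/\ well_coloured (compose l omega t u), increasing (compose l omega t u),
      out (compose l omega t u) = c &
      perm_eq (leaves (compose l omega t u))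
              (composed_leaves l omega c' chi chi')].
Proof.
move=> tt tu lc sh; rewrite (compose_substitute tt tu sh).
have [lt ut] := typed_labels tt; have [lu uu] := typed_labels tu.
have n0 : (0 < size chi')%N.
  by have := min_label_in u; rewrite lu mem_iota; lia.
have [fm gm] := shuffles_mono n0 sh; case/and4P: sh => /andP[l0 lm] _ _ _.
move: (tt) (tu); rewrite !typedE.
case/and4P=> wt it /eqP ot pt /and4P[wu iu /eqP ou pu].
set f := omega \o _; set g := omega \o _.
have {}fm : {in labels t &, {mono f : i j / (i <= j)%N}}.
  by move=> i j; rewrite !lt => hi hj; apply: fm.
have {}gm : {in labels u &, {mono g : i j / (i <= j)%N}}.
  by move=> i j; rewrite !lu => hi hj; apply: gm.
have fl : f l = omega l by rewrite /f /= /outer_shift leqnn.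
(* The smallest label of [u] is 1, which [inner_shift] sends to [l]. *)
have mu : min_label (relabel g u) = omega l.
  rewrite min_label_relabel // (@min_label_eq _ u 1%N).
  - by rewrite /g /= /inner_shift; congr omega; lia.
  - by rewrite lu mem_iota; lia.
  - by move=> j; rewrite lu mem_iota => /andP[].
have lin : (omega l, out (relabel g u)) \in leaves (relabel f t).
  rewrite leaves_relabel -fl; apply/mapP; exists (l, c'); last first.
    by rewrite out_relabel ou.
  by rewrite (perm_mem pt) mem_standard_leaves l0 /= lc.
have uf : uniq (labels (relabel f t)).
  rewrite labels_relabel map_inj_in_uniq // => i j it_ jt E.
  by apply/eqP; rewrite eqn_leq -(fm _ _ it_ jt) -(fm _ _ jt it_) E leqnn.
have [] // := substitute_spec lin uf mu; rewrite ?well_coloured_relabel //.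
- by rewrite increasing_relabel.
- by rewrite increasing_relabel.
move=> w i o _ p; split=> //; first by rewrite o out_relabel.
rewrite (perm_trans p) // /composed_leaves -/f -/g out_relabel ou.
rewrite !leaves_relabel; apply: perm_cat.
  set x := (omega l, c').
  have := perm_map (fun p : nat * colour S => (f p.1, p.2)) pt.
  move=> pf; have xi : x \in [seq (f p.1, p.2) | p <- leaves t].
    by move: lin; rewrite leaves_relabel out_relabel ou.
  have p1 : perm_eq (x :: rem x [seq (f p.1, p.2) | p <- leaves t])
                    [seq (f p.1, p.2) | p <- leaves t].
    by rewrite perm_sym perm_to_rem.
  rewrite -(perm_cons x); apply: (perm_trans p1); apply: (perm_trans pf).
  have li : (l, c') \in standard_leaves chi.
    by rewrite mem_standard_leaves l0 /= lc.
  have := perm_map (fun p : nat * colour S => (f p.1, p.2)) (perm_to_rem li).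
  by rewrite /= -/(f l) fl.
by apply: perm_map.
Qed.

Lemma shuffles_labels m n l omega : (0 < n)%N -> shuffles m n l omega ->
  perm_eq ([seq (omega \o outer_shift l n) j | j <- rem l (iota 1 m)] ++
           [seq (omega \o inner_shift l) j | j <- iota 1 n])
          (iota 1 (m + n).-1).
Proof.
move=> n0 /and4P[/andP[l0 lm] pe _ _]; apply: perm_trans pe.
rewrite (map_comp omega (outer_shift l n)) (map_comp omega (inner_shift l)).
rewrite -map_cat; apply: perm_map.
have -> : iota 1 (m + n).-1 = iota 1 l.-1 ++ iota l n ++ iota (l + n) (m - l).
  rewrite (_ : (m + n).-1 = (l.-1 + (n + (m - l)))%N); last by lia.
  by rewrite iotaD (_ : (1 + l.-1 = l)%N); [rewrite iotaD | lia].
have -> : rem l (iota 1 m) = iota 1 l.-1 ++ iota l.+1 (m - l).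
  rewrite (_ : m = (l.-1 + (1 + (m - l)))%N); last by lia.
  rewrite iotaD (_ : (1 + l.-1 = l)%N) /=; last by lia.
  rewrite rem_cat mem_iota ifN /= ?eqxx; last by lia.
  by congr (_ ++ iota _ _); lia.
have -> : [seq inner_shift l j | j <- iota 1 n] = iota l n.
  rewrite (_ : iota l n = map (addn l.-1) (iota 1 n)).
    by apply: eq_map => j; rewrite /inner_shift addnC.
  by rewrite -iotaDl addn1 prednK.
rewrite map_cat -catA perm_sym.
have -> : [seq outer_shift l n j | j <- iota 1 l.-1] = iota 1 l.-1.
  rewrite -[RHS]map_id; apply/eq_in_map => j; rewrite mem_iota => H.
  by rewrite /outer_shift ifT //; lia.
rewrite perm_cat2l perm_catC perm_cat2r perm_sym.
have -> : iota (l + n) (m - l) = map (addn n.-1) (iota l.+1 (m - l)).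
  by rewrite -iotaDl; congr iota; lia.
suff -> : map (outer_shift l n) (iota l.+1 (m - l)) =
          map (addn n.-1) (iota l.+1 (m - l)) by [].
apply/eq_in_map => j; rewrite mem_iota => H.
by rewrite /outer_shift ifN; lia.
Qed.

Lemma compose_component l omega chi c chi' c' :
  onth chi l.-1 = Some c' -> shuffles (size chi) (size chi') l omega ->
  exists chi'', forall t u, typed chi c t -> typed chi' c' u ->
    typed chi'' c (compose l omega t u).
Proof.
move=> lc sh; have [n0|n0] := posnP (size chi').
  (* Every tree has a leaf, so for an empty [chi'] the claim is vacuous and any list serves. *)
  exists [::] => t u _ tu; have [lu _] := typed_labels tu.
  by have := min_label_in u; rewrite lu n0.
have := sh => /and4P[/andP[l0 lm] _ _ _].
have lin : (l, c') \in standard_leaves chi.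
  by rewrite mem_standard_leaves l0 /= lc.
have [|chi'' p''] := @standardizable S (composed_leaves l omega c' chi chi').
  have cs : size (composed_leaves l omega c' chi chi') =
            (size chi + size chi').-1.
    rewrite size_cat !size_map size_rem // !size_standard_leaves.
    by move: lm l0; case: (size chi) => //; lia.
  rewrite cs; apply: perm_trans (shuffles_labels n0 sh).
  rewrite /composed_leaves /unzip1 map_cat -!map_comp; apply: perm_cat.
    have := map_comp (omega \o outer_shift l (size chi')) fst
      (rem (l, c') (standard_leaves chi)).
    rewrite -[X in _ = X -> _]/(map _ (unzip1 _)) => E.
    rewrite [X in perm_eq X](_ : _ = map (omega \o outer_shift l (size chi'))
          (unzip1 (rem (l, c') (standard_leaves chi)))); last first.
      by rewrite -E; apply: eq_map.
    apply: perm_map; rewrite -(perm_cons l).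
    have i1 : l \in iota 1 (size chi) by rewrite mem_iota l0 /=; lia.
    apply: perm_trans (perm_to_rem i1); rewrite -unzip1_standard_leaves.
    by rewrite perm_sym (perm_map fst (perm_to_rem lin)).
  rewrite -unzip1_standard_leaves /unzip1 -[X in perm_eq _ X]map_comp.
  by rewrite (eq_map (g := (omega \o inner_shift l) \o fst)).
exists chi'' => t u tt tu; rewrite typedE.
have [-> -> -> p] := compose_typed tt tu lc sh.
by rewrite eqxx (perm_trans p).
Qed.

End Composition.

Lemma malg_msupp_eq0 (K : choiceType) (k : nzRingType) (g : {malg k[K]}) :
  (msupp g == fset0) = (g == 0).
Proof.
apply/eqP/eqP=> [z|->]; last exact: msupp0.
by apply/malgP=> x; rewrite mcoeff0 mcoeff_outdom // z.
Qed.

(** * Evaluation in an associative algebra and its kernel *)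

Section Evaluation.
Variables (k : fieldType) (B : algType k).
Implicit Types (t u : tree lp_sig) (phi : lp_colour -> nat -> B).

Definition gen_op (g : lp_gen) (x y : B) : B :=
  match g with
  | Beta | Gd => x * y - y * x
  | Ga => x * y
  | Gb => y * x
  | Ge => y * x - x * y
  end.

Fixpoint eval phi t : B :=
  match t with
  | Leaf c j => phi c j
  | Node g s u => gen_op g (eval phi s) (eval phi u)
  end.

Lemma gen_op_linear_l g y : linear (gen_op g ^~ y).
Proof.
move=> c x x'; case: g => /=;
  rewrite ?mulrDl ?mulrDr -?scalerAl -?scalerAr ?scalerBr //.
- by rewrite opprD addrACA.
- by rewrite opprD addrACA.
- by rewrite opprD addrACA.
Qed.

Lemma gen_op_linear_r g x : linear (gen_op g x).
Proof.
move=> c y y'; case: g => /=;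
  rewrite ?mulrDl ?mulrDr -?scalerAl -?scalerAr ?scalerBr //.
- by rewrite opprD addrACA.
- by rewrite opprD addrACA.
- by rewrite opprD addrACA.
Qed.

Lemma eq_eval phi phi' t :
  (forall c j, j \in labels t -> phi c j = phi' c j) ->
  eval phi t = eval phi' t.
Proof.
elim: t => [c j|g s IHs u IHu] /= E; first by rewrite E // inE.
by congr gen_op; [apply: IHs|apply: IHu] => c j jt; apply: E;
   rewrite labels_node mem_cat jt ?orbT.
Qed.

Lemma eval_relabel phi f t :
  eval phi (relabel f t) = eval (fun c j => phi c (f j)) t.
Proof. by elim: t => //= g s -> u ->. Qed.

Definition update phi l b c j := if j == l then b else phi c j.

Lemma eval_substitute phi t l r :
  eval phi (substitute t l r) = eval (update phi l (eval phi r)) t.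
Proof.
elim: t => [c j|g s IHs u IHu] /=; first by rewrite /update; case: eqP.
by rewrite IHs IHu.
Qed.

(** The label [l] occurs exactly once, so only one branch at each vertex depends on [b], and every
    operation is bilinear. *)
Lemma eval_update_linear phi t l : uniq (labels t) -> l \in labels t ->
  linear (fun b => eval (update phi l b) t).
Proof.
elim: t => [c j|g s IHs u IHu] /=.
  by rewrite inE => _ /eqP -> a b b'; rewrite /update eqxx.
rewrite labels_node cat_uniq mem_cat => /and3P[us /hasPn dis uu].
have const v b b' : l \notin labels v ->
    eval (update phi l b) v = eval (update phi l b') v.
  move=> lv; apply: eq_eval => c j jv; rewrite /update.
  by case: eqP => // E; rewrite -E jv in lv.
have [ls _|ls /= lu] := boolP (l \in labels s) => a b b'.
  have lu : l \notin labels u by apply/negP => /dis; rewrite /= ls.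
  rewrite IHs // gen_op_linear_l.
  by rewrite (const u _ b) // (const u b' b).
rewrite IHu // gen_op_linear_r (const s _ b) //.
by rewrite (const s b' b).
Qed.

Lemma linextE (S S' : signature) (h : tree S -> {malg k[tree S']}) f :
  linext h f = mlin h f.
Proof. by []. Qed.

Definition eval_lin phi : {malg k[tree lp_sig]} -> B := mlin (eval phi).

(** All assignments are allowed, not only generic letters: composition puts the value of the inner
    element, which is rarely a letter, in the place of a leaf. *)
Definition eval_kernel (f : {malg k[tree lp_sig]}) : Prop :=
  (exists chi c, in_component chi c f) /\ forall phi, eval_lin phi f = 0.

Lemma mlin_sum (K : choiceType) (V : lmodType k) (h : K -> V)
    (I : Type) (r : seq I) (F : I -> {malg k[K]}) (a : I -> k) :
  mlin h (\sum_(i <- r) a i *: F i) = \sum_(i <- r) a i *: mlin h (F i).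
Proof. by rewrite linear_sum; apply: eq_bigr => i _; rewrite linearZ. Qed.

Lemma eval_lin_mcompose phi l omega chi c chi' c' f g :
  in_component chi c f -> in_component chi' c' g -> g != 0 ->
  onth chi l.-1 = Some c' -> shuffles (size chi) (size chi') l omega ->
  eval_lin phi (mcompose l omega f g) =
  \sum_(t <- msupp f) f@_t *:
     eval (fun d j => update phi (omega l)
             (eval_lin (fun d j => phi d ((omega \o inner_shift l) j)) g)
             d ((omega \o outer_shift l (size chi')) j)) t.
Proof.
move=> fc gc; rewrite -malg_msupp_eq0 => /fset0Pn[u0 u0g] lc sh.
rewrite /mcompose linextE /eval_lin mlin_sum.
rewrite big_seq [RHS]big_seq; apply: eq_bigr => t tf; congr (_ *: _).
have tt := fc _ tf; have [lt ut] := typed_labels tt.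
have lin : l \in labels t.
  have /and4P[/andP[l0 lm] _ _ _] := sh; rewrite lt mem_iota l0 /=.
  by rewrite add1n ltnS.
have n0 : (0 < size chi')%N.
  have [lu _] := typed_labels (gc _ u0g).
  by have := min_label_in u0; rewrite lu mem_iota; lia.
have [fm _] := shuffles_mono n0 sh.
have eqj : {in labels t, forall j,
    ((omega \o outer_shift l (size chi')) j == omega l) = (j == l)}.
  move=> j jt.
  have <- : (omega \o outer_shift l (size chi')) l = omega l.
    by rewrite /= /outer_shift leqnn.
  by rewrite !eqn_leq !fm // -lt.
pose psi d j := phi d ((omega \o outer_shift l (size chi')) j).
pose L b := eval (update psi l b) t.
(* Seen as a linear map of the value at [l], the evaluation of [t] lets the sum over the terms of
   [g] pass through. *)
pose lin_ := GRing.isLinear.Build k B B _ L (eval_update_linear psi ut lin).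
pose Ll : {linear B -> B} := HB.pack L lin_.
transitivity (Ll (eval_lin (fun d j => phi d ((omega \o inner_shift l) j)) g));
  last first.
  by apply: eq_eval => d j jt; rewrite /update eqj.
rewrite /linext mlin_sum /eval_lin [X in Ll X]/mlin linear_sum big_seq [RHS]big_seq.
apply: eq_bigr => u ug; rewrite linearZ mlinU; congr (_ *: _).
rewrite (compose_substitute tt (gc _ ug) sh) eval_substitute !eval_relabel.
by apply: eq_eval => d j jt; rewrite /update eqj.
Qed.

Lemma in_componentD (chi : seq (colour lp_sig)) (c : colour lp_sig)
    (f g : {malg k[tree lp_sig]}) :
  in_component chi c f -> in_component chi c g -> in_component chi c (f + g).
Proof.
move=> fc gc t /(fsubsetP (msuppD_le f g)); rewrite in_fsetU.
by case/orP => [/fc|/gc].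
Qed.

Lemma in_componentZ (chi : seq (colour lp_sig)) (c : colour lp_sig) (x : k)
    (f : {malg k[tree lp_sig]}) : in_component chi c f -> in_component chi c (x *: f).
Proof. by move=> fc t /(fsubsetP (msuppZ_le x f)) /fc. Qed.

Lemma in_component_sum (chi : seq (colour lp_sig)) (c : colour lp_sig)
    (I : eqType) (r : seq I) (a : I -> k) (F : I -> {malg k[tree lp_sig]}) :
  {in r, forall i, in_component chi c (F i)} ->
  in_component chi c (\sum_(i <- r) a i *: F i).
Proof.
elim: r => [|i r IHr] H; first by rewrite big_nil => t; rewrite msupp0.
rewrite big_cons; apply: in_componentD.
  by apply/in_componentZ/H; rewrite inE eqxx.
by apply: IHr => j jr; apply: H; rewrite inE jr orbT.
Qed.

Lemma eval_kernel_ideal : operadic_ideal eval_kernel.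
Proof.
have empty : exists chi c, @in_component k lp_sig chi c 0.
  by exists [::], colA => t; rewrite msupp0.
split=> [f []//||chi c f g fc gc [_ f0] [_ g0]|x f [[chi [c fc]] f0]|].
- by split=> // phi; rewrite /eval_lin linear0.
- split; first by exists chi, c; apply: in_componentD.
  by move=> phi; rewrite /eval_lin linearD /= [mlin _ f](f0 phi) [mlin _ g](g0 phi) addr0.
- split; first by exists chi, c; apply: in_componentZ.
  by move=> phi; rewrite /eval_lin linearZ /= [mlin _ f](f0 phi) scaler0.
move=> l omega chi c chi' c' f g fc gc lc sh fg; split.
  have [chi'' H] := compose_component c lc sh.
  exists chi'', c; apply: in_component_sum => t tf.
  apply: in_component_sum => u ug s.
  by move/(fsubsetP msuppU_le); rewrite inE => /eqP ->; apply: H; [apply: fc|apply: gc].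
move=> phi; have [->|g0] := eqVneq g 0.
  rewrite /mcompose /linext msupp0; under eq_bigr do rewrite big_nil scaler0.
  by rewrite big1_eq /eval_lin linear0.
rewrite (eval_lin_mcompose phi fc gc g0 lc sh).
(* If [f] is in the kernel, the sum is the evaluation of [f] at a modified assignment. *)
case: fg => [[_ f0]|[_ g_0]]; first exact: f0.
rewrite g_0 big_seq big1 // => t tf.
have [lt ut] := typed_labels (fc _ tf).
have lin : l \in labels t.
  have /and4P[/andP[l0 lm] _ _ _] := sh; rewrite lt mem_iota l0 /=.
  by rewrite add1n ltnS.
set psi := fun d j => phi d ((omega \o outer_shift l (size chi')) j).
have n0 : (0 < size chi')%N.
  move: g0; rewrite -malg_msupp_eq0 => /fset0Pn[u0 u0g].
  have [lu _] := typed_labels (gc _ u0g).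
  by have := min_label_in u0; rewrite lu mem_iota; lia.
(* If [g] is in the kernel, the leaf [l] receives the value 0, and linearity in that leaf gives
   0. *)
rewrite (eq_eval (phi' := update psi l 0)) => [|d j jt].
  have := eval_update_linear psi ut lin (-1) 0 0.
  by rewrite scaler0 addr0 scaleN1r addNr => ->; rewrite scaler0.
have [fm _] := shuffles_mono n0 sh.
have fl : (omega \o outer_shift l (size chi')) l = omega l.
  by rewrite /= /outer_shift leqnn.
by rewrite /update -fl !eqn_leq !fm // -lt.
Qed.

End Evaluation.

(** * The relations as explicit signed lists *)

Section SignedSums.
Variables (k : fieldType) (K : choiceType).

(** All coefficients of the relations are 1 or -1; encoding them as booleans makes the relations
    computable data, independent of the field. *)
Definition signed_sum (l : seq (bool * K)) : {malg k[K]} :=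
  \sum_(p <- l) (-1) ^+ p.1 *: << p.2 >>.

Definition signed (p : bool * K) : {malg k[K]} :=
  if p.1 then - << p.2 >> else << p.2 >>.

Lemma signed_sumE l : signed_sum l = \sum_(p <- l) signed p.
Proof.
apply: eq_bigr => -[b t] _; rewrite /signed.
by case: b; rewrite /= ?expr1 ?expr0 ?scaleN1r ?scale1r.
Qed.

Lemma signed_sum2 p q : signed_sum [:: p; q] = signed p + signed q.
Proof. by rewrite signed_sumE big_cons big_seq1. Qed.

Lemma signed_sum3 p q r :
  signed_sum [:: p; q; r] = signed p + signed q + signed r.
Proof. by rewrite signed_sumE !big_cons big_nil addr0 addrA. Qed.

Lemma msupp_signed_sum l t : t \in msupp (signed_sum l) -> t \in map snd l.
Proof.
apply: contraLR => tl; rewrite -mcoeff_eq0 /signed_sum raddf_sum /=.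
rewrite big_seq big1 // => p pl; rewrite mcoeffZ mcoeffU.
by case: eqP => [E|]; rewrite ?mulr0 //; rewrite -E map_f in tl.
Qed.

Lemma mcoeff_signed_sumE l t :
  (signed_sum l)@_t = \sum_(p <- l) (-1) ^+ p.1 *+ (p.2 == t).
Proof.
rewrite /signed_sum raddf_sum /=; apply: eq_bigr => p _.
by rewrite mcoeffZ mcoeffU mulrnAr mulr1.
Qed.

Lemma mcoeff_signed_sum l p : uniq (map snd l) -> p \in l ->
  (signed_sum l)@_p.2 = (-1) ^+ p.1.
Proof.
move=> ul pl; rewrite mcoeff_signed_sumE (bigD1_seq p pl (map_uniq ul)) /=.
rewrite eqxx mulr1n [X in _ + X]big_seq_cond.
rewrite [X in _ + X]big1 ?addr0 // => q /andP[ql qp].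
case: eqP => [E|]; last by rewrite mulr0n.
by rewrite (uniq_map_inj ul ql pl E) eqxx in qp.
Qed.

End SignedSums.

Section SymmetricRelations.
Local Notation beta := (@Node sym_sig SBeta).
Local Notation a := (@Node sym_sig Sa).
Local Notation d := (@Node sym_sig Sd).
Local Notation A j := (@Leaf sym_sig colA j%N).
Local Notation L j := (@Leaf sym_sig colL j%N).

Definition sym_relations : seq (seq (bool * tree sym_sig)) :=
  [:: [:: (false, beta (beta (L 1) (L 2)) (L 3));
          (true, beta (beta (L 1) (L 3)) (L 2));
          (true, beta (L 1) (beta (L 2) (L 3)))];
      [:: (false, a (a (A 1) (A 2)) (A 3)); (true, a (A 1) (a (A 2) (A 3)))];
      [:: (false, d (L 1) (a (A 2) (A 3))); (true, a (A 2) (d (L 1) (A 3)));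
          (true, a (d (L 1) (A 2)) (A 3))];
      [:: (false, d (beta (L 1) (L 2)) (A 3));
          (true, d (L 1) (d (L 2) (A 3)));
          (false, d (L 2) (d (L 1) (A 3)))]].

End SymmetricRelations.

(** The list [s] gives the images of 1, 2, 3; the 0 put in front shifts indices so that label [j]
    goes to the [j]-th entry. *)
Definition shuffled (s : seq nat) (p : bool * tree sym_sig) :=
  let: (e, t) := shuffle_form (relabel (nth 0%N (0%N :: s)) p.2) in
  (p.1 (+) e, t).

Definition shuffle_relations : seq (seq (bool * tree lp_sig)) :=
  [seq map (shuffled s) r | r <- sym_relations, s <- permutations (iota 1 3)].

Section Relations.
Variable k : fieldType.

Lemma lp_relationsE : lp_relations k = map (@signed_sum k (tree sym_sig)) sym_relations.
Proof.
rewrite /sym_relations 4!map_cons [map _ [::]]/=.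
by rewrite signed_sum2 !signed_sum3.
Qed.

Lemma to_shuffle_act sigma r :
  {in map snd r, forall t, {subset labels t <= iota 1 3}} ->
  to_shuffle (act sigma (@signed_sum k (tree sym_sig) r)) =
  signed_sum k (map (shuffled [seq sigma j | j <- iota 1 3]) r).
Proof.
move=> lr; rewrite /act linextE mlin_sum /to_shuffle linextE mlin_sum.
rewrite /signed_sum [RHS]big_map big_seq [RHS]big_seq.
apply: eq_bigr => p pr.
rewrite !mlinU /shuffled (eq_relabel (f' := sigma)) => [|j jp].
  by case: shuffle_form => e t; rewrite signr_addb scalerA.
have := lr _ (map_f snd pr) _ jp; rewrite /= !inE.
by case/or3P=> /eqP ->.
Qed.

(** Only the values of [sigma] at 1, 2, 3 matter, so the functions permuting these labels reduce to
    six lists. *)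
Lemma lp_shuffle_relationsP f :
  lp_shuffle_relations f <->
  exists2 r, r \in shuffle_relations & f = signed_sum k r.
Proof.
have lr : {in sym_relations, forall r, {in map snd r, forall t,
    {subset labels t <= iota 1 3}}}.
  have H : all (fun r => all (fun t => all (fun j => j \in iota 1 3) (labels t))
    (map snd r)) sym_relations by [].
  by move=> r /(allP H) {}H t /(allP H) {}H j /(allP H).
split=> [[r0 [sigma [+ ps ->]]]|[r0 /allpairsP[[r s] [/= rr ss ->]] ->]].
  rewrite lp_relationsE => /mapP[r rr ->].
  rewrite (to_shuffle_act _ (lr _ rr)).
  exists (map (shuffled [seq sigma j | j <- iota 1 3]) r) => //.
  by apply: allpairs_f; rewrite ?mem_permutations.
exists (signed_sum k r), (nth 0%N (0%N :: s)).
have ps : perm_eq s (iota 1 3) by rewrite -mem_permutations.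
have Es : [seq nth 0%N (0%N :: s) j | j <- iota 1 3] = s.
  by have := perm_size ps; case: s {ss ps} => [|x [|y [|z [|]]]].
split; first by rewrite lp_relationsE map_f.
  by rewrite /permutes Es.
by rewrite (to_shuffle_act _ (lr _ rr)) Es.
Qed.

Lemma shuffle_relations_typed r : r \in shuffle_relations ->
  exists chi c, in_component chi c (signed_sum k r).
Proof.
(* All eight input colourings and both output colours are tried. *)
pose cs := [:: colA; colL] : seq (colour lp_sig).
have H : all (fun r => has (fun x => all (fun p => typed x.1 x.2 p.2) r)
   [seq (x, c) | x <- [seq c :: x | c <- cs, x <-
      [seq c :: x | c <- cs, x <- [seq [:: c] | c <- cs]]], c <- cs])
   shuffle_relations by vm_compute.
move/(allP H)/hasP=> [[chi c] _ /allP /= {}H]; exists chi, c => t.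
by move/msupp_signed_sum/mapP=> [p /H pt ->].
Qed.

Lemma lp_quadratic : quadratic (@lp_shuffle_relations k).
Proof.
have H : all (fun r => all (fun p => vertices p.2 == 2%N) r) shuffle_relations.
  by vm_compute.
move=> g t /lp_shuffle_relationsP[r /(allP H) /allP {}H ->].
by move/msupp_signed_sum/mapP=> [p /H /eqP pt ->].
Qed.

Section Kernel.
Variable B : algType k.

Definition sym_op (g : sym_gen) (x y : B) : B :=
  match g with SBeta | Sd => x * y - y * x | Sa => x * y end.

Fixpoint sym_eval (phi : lp_colour -> nat -> B) (t : tree sym_sig) : B :=
  match t with
  | Leaf c j => phi c j
  | Node g s u => sym_op g (sym_eval phi s) (sym_eval phi u)
  end.

Lemma sym_opZ g b c x y : sym_op g (b *: x) (c *: y) = (b * c) *: sym_op g x y.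
Proof.
by case: g; rewrite /= -?scalerAl -?scalerAr ?scalerBr !scalerA ?[c * b]mulrC.
Qed.

Lemma gen_op_opposite g x y :
  (-1) ^+ (opposite_gen g).1 *: gen_op (opposite_gen g).2 y x = sym_op g x y.
Proof.
by case: g; rewrite /= ?expr1 ?expr0 ?scale1r // scaleN1r opprB.
Qed.

Lemma eval_shuffle_form phi t :
  (-1) ^+ (shuffle_form t).1 *: eval phi (shuffle_form t).2 = sym_eval phi t.
Proof.
elim: t => [c j|g s + u] /=; first by rewrite expr0 scale1r.
case: (shuffle_form s) (shuffle_form u) => [e s'] [e' u'] /= <- <-.
rewrite sym_opZ -signr_addb; case: ifP => _; first by case: g.
rewrite -gen_op_opposite; case: opposite_gen => e0 g' /=.
by rewrite scalerA -signr_addb addbC.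
Qed.

Lemma sym_eval_relabel phi f t :
  sym_eval phi (relabel f t) = sym_eval (fun c j => phi c (f j)) t.
Proof. by elim: t => //= g s -> u ->. Qed.

(** The Jacobi identity, associativity, the Leibniz rule for an inner derivation, and the Jacobi
    identity again. In each commutator case the expanded words are regrouped so that each one meets
    its negative. *)
Lemma sym_relations_eval phi r : r \in sym_relations ->
  \sum_(p <- r) (-1) ^+ p.1 *: sym_eval phi p.2 = 0.
Proof.
rewrite !inE => H; rewrite (eq_bigr (fun p =>
  if p.1 then - sym_eval phi p.2 else sym_eval phi p.2)); last first.
  by case=> [[] t] _; rewrite /= ?expr1 ?expr0 ?scaleN1r ?scale1r.
case/or4P: H => /eqP ->; rewrite !big_cons big_nil /= addr0.
- set x := phi _ 1%N; set y := phi _ 2%N; set z := phi _ 3%N.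
  rewrite !(mulrBl, mulrBr, mulrA, opprB, opprD, addrA).
  rewrite [LHS](@GRing.add B).[ACl ((1*12)*(5*2)*(3*10)*(7*4)*(9*6)*(11*8))].
  by rewrite !subrr !addr0.
- by rewrite mulrA subrr.
- set x := phi _ 1%N; set y := phi _ 2%N; set z := phi _ 3%N.
  rewrite !(mulrBl, mulrBr, mulrA, opprB, opprD, addrA).
  rewrite [LHS](@GRing.add B).[ACl ((1*6)*(3*2)*(5*4))].
  by rewrite !subrr !addr0.
- set x := phi _ 1%N; set y := phi _ 2%N; set z := phi _ 3%N.
  rewrite !(mulrBl, mulrBr, mulrA, opprB, opprD, addrA).
  rewrite [LHS](@GRing.add B).[ACl ((1*8)*(9*2)*(3*6)*(11*4)*(5*10)*(7*12))].
  by rewrite !subrr !addr0.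
Qed.

Lemma shuffle_relations_eval phi r : r \in shuffle_relations ->
  \sum_(p <- r) (-1) ^+ p.1 *: @eval k B phi p.2 = 0.
Proof.
case/allpairsP=> [[r0 s] [/= rr _ ->]]; rewrite big_map.
apply: etrans (sym_relations_eval
  (fun c j => phi c (nth 0%N (0%N :: s) j)) rr).
apply: eq_bigr => p _; rewrite -sym_eval_relabel -eval_shuffle_form /shuffled.
by case: shuffle_form => e t; rewrite signr_addb scalerA.
Qed.

(** The kernel is one of the ideals over which [generated_ideal] quantifies. *)
Lemma lp_ideal_kernel f : lp_ideal f -> eval_kernel B f.
Proof.
apply; first exact: eval_kernel_ideal.
move=> g /lp_shuffle_relationsP[r rr ->]; split.
  exact: shuffle_relations_typed.
move=> phi; rewrite /eval_lin /signed_sum mlin_sum.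
under eq_bigr do rewrite mlinU.
exact: shuffle_relations_eval.
Qed.

End Kernel.
End Relations.

(** * Comparison of path words and of trees *)

Section Words.
Implicit Types (w v u : seq lp_gen).

(** The number of pairs in which a letter of type y precedes a letter of type x; each such pair
    yields one q. *)
Fixpoint q_degree w : nat :=
  if w is g :: w' then
    if lp_is_x g then q_degree w' else (size (filter lp_is_x w') + q_degree w')%N
  else 0%N.

Lemma qm_normal_formE w :
  @qm_normal_form lp_sig lp_is_x w =
  (filter lp_is_x w, filter (predC lp_is_x) w, q_degree w).
Proof. by elim: w => //= g w ->; case: (lp_is_x g). Qed.

Lemma q_degree_cat u v : q_degree (u ++ v) =
  (q_degree u + q_degree v
   + size (filter (predC lp_is_x) u) * size (filter lp_is_x v))%N.
Proof.
elim: u => [|g u IHu] //=; first by rewrite addn0.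
case: (lp_is_x g); rewrite /= IHu ?filter_cat ?size_cat ?mulSn //.
by rewrite [LHS]addn.[AC (2*3) (1*3*4*(2*5))].
Qed.

Definition letter_lt (g h : lp_gen) : bool :=
  (g, h) \in [:: (Gb, Ga); (Ge, Gd)].

(** Prefixes are not compared: [word_ltb] consults this function on words of equal length only. *)
Fixpoint lexb w w' : bool :=
  if (w, w') is (g :: v, g' :: v') then
    letter_lt g g' || (g == g') && lexb v v'
  else false.

Lemma lexb_cat u w w' v : lexb w w' -> lexb (u ++ w ++ v) (u ++ w' ++ v).
Proof.
move=> lt; elim: u => /= [|g u ->]; last by rewrite eqxx orbT.
elim: w w' lt => [|g w IHw] [|g' w'] //= /orP[->//|/andP[-> /IHw->]].
by rewrite orbT.
Qed.

(* The strict comparison of words that uses only the prescribed inequalities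
   between letters. *)
Definition word_ltb w w' : bool :=
  let: X := filter lp_is_x w in let: X' := filter lp_is_x w' in
  let: Y := filter (predC lp_is_x) w in let: Y' := filter (predC lp_is_x) w' in
  (size X' < size X)%N || (size X == size X') &&
  (lexb X X' || (X == X') &&
  ((size Y < size Y')%N || (size Y == size Y') &&
  (lexb Y Y' || (Y == Y') && (q_degree w < q_degree w')%N))).

(** A common context adds the same amount to both lengths and keeps the first difference of letters;
    once both subwords agree, it adds the same number of crossings to both degrees in q. *)
Lemma word_ltb_cat u w w' v :
  word_ltb w w' -> word_ltb (u ++ w ++ v) (u ++ w' ++ v).
Proof.
rewrite /word_ltb !filter_cat !size_cat !ltn_add2l !ltn_add2r !eqn_add2l !eqn_add2r.
case/orP=> [->//|/andP[-> H]]; apply/orP; right; rewrite /=.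
case/orP: H => [lt|/andP[/eqP EX H]]; first by rewrite lexb_cat.
rewrite EX eqxx /=; apply/orP; right.
case/orP: H => [->//|/andP[-> H]]; apply/orP; right; rewrite /=.
case/orP: H => [lt|/andP[/eqP EY H]]; first by rewrite lexb_cat.
rewrite EY eqxx /=; apply/orP; right.
by rewrite !q_degree_cat !filter_cat !size_cat EX EY; lia.
Qed.

Lemma word_ltb_cons g w w' : word_ltb w w' -> word_ltb (g :: w) (g :: w').
Proof. by move/(word_ltb_cat [:: g] [::]); rewrite !cats0. Qed.

Section Ranked.
Variable rk : lp_gen -> nat.
Hypotheses (rk_ab : (rk Gb < rk Ga)%N) (rk_de : (rk Ge < rk Gd)%N).

Lemma lexb_lex_lt w w' : lexb w w' -> @lex_lt lp_sig rk w w'.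
Proof.
rewrite /lex_lt; elim: w w' => [|g w IHw] [|g' w'] //= /orP[lt|/andP[/eqP<- lt]].
  have rlt : (rk g < rk g')%N.
    by move: lt; rewrite /letter_lt !inE => /orP[] /eqP[-> ->].
  by rewrite ltxi_cons !leEnat ltnW //= leqNgt rlt.
by rewrite ltxi_cons lexx /= IHw.
Qed.

Lemma word_ltb_qm w w' : word_ltb w w' -> @qm_word_lt lp_sig lp_is_x rk w w'.
Proof.
rewrite /word_ltb /qm_word_lt !qm_normal_formE.
case/orP=> [lt|/andP[/eqP sX H]]; [by left|right; split=> //].
case/orP: H => [lt|/andP[/eqP EX H]]; first by left; apply: lexb_lex_lt.
right; split=> //.
case/orP: H => [lt|/andP[/eqP sY H]]; [by left|right; split=> //].
case/orP: H => [lt|/andP[/eqP EY H]]; first by left; apply: lexb_lex_lt.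
by right.
Qed.

End Ranked.
End Words.

Section Lower.
Implicit Types (s t u : tree lp_sig).

(* A witness of [qm_lt t' t] that, unlike [qm_lt], survives grafting [t'] and [t]
   into a common context: no condition is imposed on labels outside of [t]. *)
Definition lower t' t : Prop := exists j, [/\ j \in labels t,
  {in labels t, forall i, (i < j)%N -> path_word i t' = path_word i t} &
  word_ltb (path_word j t') (path_word j t)].

(** [path_word] chooses a branch by membership in the labels of the left one; equal label sets and
    disjointness keep that choice unchanged. *)
Lemma lower_left g s s' u : labels s' =i labels s ->
  {in labels u, forall i, i \notin labels s} ->
  lower s' s -> lower (Node g s' u) (Node g s u).
Proof.
move=> ss' su [j [js low lt]]; exists j; split.
- by rewrite labels_node mem_cat js.
- move=> i; rewrite labels_node mem_cat /= ss' => /orP[is_|iu] ij.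
    by rewrite is_ low.
  by rewrite (negbTE (su i iu)).
by rewrite /= ss' js word_ltb_cons.
Qed.

Lemma lower_right g s u u' : labels u' =i labels u ->
  {in labels u, forall i, i \notin labels s} ->
  lower u' u -> lower (Node g s u') (Node g s u).
Proof.
move=> ss' su [j [js low lt]]; exists j; split.
- by rewrite labels_node mem_cat js orbT.
- move=> i; rewrite labels_node mem_cat /= => /orP[is_|iu] ij.
    by rewrite is_.
  by rewrite (negbTE (su i iu)) low.
by rewrite /= (negbTE (su j js)) word_ltb_cons.
Qed.

Lemma lower_qm_lt rk t t' : (rk Gb < rk Ga)%N -> (rk Ge < rk Gd)%N ->
  arity t' = arity t -> labels t =i iota 1 (arity t) -> lower t' t ->
  @qm_lt lp_sig lp_is_x rk t' t.
Proof.
move=> ab de ar lt [j [jt low wlt]]; right; split=> //; exists j; split.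
- by move: jt; rewrite lt mem_iota ar add1n ltnS.
- move=> i /andP[i0 ij]; rewrite low // lt mem_iota i0.
  by move: jt; rewrite lt mem_iota; lia.
- exact: word_ltb_qm.
Qed.

End Lower.

(** * Grafting branches on a pattern, and rewriting *)

Section Grafting.
Variable S : signature.
Implicit Types (P s t u : tree S) (f : nat -> tree S).

(** Simultaneous substitution: [P] is a tree occurring in a relation and [f] gives the branches hung
    on its leaves. *)
Fixpoint graft P f : tree S :=
  match P with
  | Leaf _ j => f j
  | Node g s u => Node g (graft s f) (graft u f)
  end.

Lemma leaves_graft P f :
  leaves (graft P f) = flatten [seq leaves (f j) | j <- labels P].
Proof.
elim: P => [c j|g s IHs u IHu] /=; first by rewrite cats0.
by rewrite labels_node map_cat flatten_cat IHs IHu.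
Qed.

Lemma labels_graft P f :
  labels (graft P f) = flatten [seq labels (f j) | j <- labels P].
Proof.
rewrite /labels leaves_graft /unzip1 map_flatten -map_comp.
by congr flatten; apply: eq_map.
Qed.

Lemma min_label_graft P f :
  min_label (graft P f) = min_label (relabel (fun j => min_label (f j)) P).
Proof. by elim: P => //= g s -> u ->. Qed.

Lemma increasing_graft P f :
  increasing (relabel (fun j => min_label (f j)) P) ->
  {in labels P, forall j, increasing (f j)} -> increasing (graft P f).
Proof.
elim: P => [c j|g s IHs u IHu] /=; first by move=> _; apply; rewrite inE.
case/and3P=> lt is_ iu H; rewrite !min_label_graft lt /= IHs ?IHu // => j jP;
  by apply: H; rewrite labels_node mem_cat jP ?orbT.
Qed.

Definition colour_compatible P f : bool :=
  all (fun p => out (f p.1) == p.2) (leaves P).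

Lemma out_graft P f : colour_compatible P f -> out (graft P f) = out P.
Proof. by case: P => //= c j /andP[/eqP]. Qed.

Lemma well_coloured_graft P f : colour_compatible P f ->
  {in labels P, forall j, well_coloured (f j)} ->
  well_coloured (graft P f) = well_coloured P.
Proof.
elim: P => [c j|g s IHs u IHu] /=; first by move=> _; apply; rewrite inE.
rewrite /colour_compatible all_cat => /andP[cs cu] H.
rewrite !out_graft // IHs ?IHu // => j jP;
  by apply: H; rewrite labels_node mem_cat jP ?orbT.
Qed.

Lemma path_word_graft P f i j : j \in labels P -> i \in labels (f j) ->
  {in labels P, forall j', i \in labels (f j') -> j' = j} ->
  path_word i (graft P f) = path_word j P ++ path_word i (f j).
Proof.
elim: P => [c j'|g s IHs u IHu]; first by rewrite inE => /eqP ->.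
rewrite labels_node mem_cat => jP ij H /=; rewrite labels_graft.
have -> : (i \in flatten [seq labels (f j0) | j0 <- labels s]) = (j \in labels s).
  apply/flattenP/idP => [[_ /mapP[j' j's ->] ij']|js].
    have jn : j' \in labels s ++ labels u by rewrite mem_cat j's.
    by rewrite -(H _ jn ij').
  by exists (labels (f j)) => //; apply: map_f.
case: ifP jP => /= [js _|_ ju]; rewrite ?IHs ?IHu //= => j' jP;
  by apply: H; rewrite mem_cat jP ?orbT.
Qed.

Lemma prunings_graft P f :
  graft P (fun j => Leaf (out (f j)) (min_label (f j))) \in prunings (graft P f).
Proof.
elim: P => [c j|g s IHs u IHu] /=; first by case: (f j) => *; rewrite inE eqxx.
by rewrite inE; apply/orP; right; apply: allpairs_f.
Qed.

Lemma graft_relabel P f : colour_compatible P f ->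
  graft P (fun j => Leaf (out (f j)) (min_label (f j))) =
  relabel (fun j => min_label (f j)) P.
Proof.
elim: P => [c j|g s IHs u IHu] /=; first by case/andP=> /eqP ->.
by rewrite /colour_compatible all_cat => /andP[cs cu]; rewrite IHs ?IHu.
Qed.

(** An increasing [m] sends 1, ..., n to the sorted labels in this order, so ranking undoes it. *)
Lemma standardize_relabel m n P : perm_eq (labels P) (iota 1 n) ->
  {in iota 1 n &, {mono m : i j / (i <= j)%N}} ->
  standardize (relabel m P) = P.
Proof.
move=> pP mono; rewrite /standardize relabel_comp labels_relabel.
have minj : {in iota 1 n &, injective m}.
  move=> i j it_ jt E; apply/eqP.
  by rewrite eqn_leq -(mono _ _ it_ jt) -(mono _ _ jt it_) E leqnn.
have -> : sort leq [seq m j | j <- labels P] = [seq m j | j <- iota 1 n].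
  apply: (sorted_eq leq_trans anti_leq).
  - exact/sort_sorted/leq_total.
  - rewrite sorted_map; apply: (sub_in_sorted (P := mem (iota 1 n)) (e := leq)).
    + by move=> i j it_ jt /= ij; rewrite mono.
    + by apply/allP.
    + exact: iota_sorted.
  - by rewrite perm_sort; apply: perm_map.
rewrite -[RHS](_ : relabel id P = P); last by elim: (P) => //= g s -> u ->.
apply: eq_relabel => j; rewrite (perm_mem pP) => jt /=.
have lt : (j.-1 < n)%N by move: jt; rewrite mem_iota; lia.
have Ej : j = nth 0%N (iota 1 n) j.-1.
  by rewrite nth_iota //; move: jt; rewrite mem_iota; lia.
rewrite {1}Ej -(nth_map 0%N 0%N) ?size_iota // index_uniq ?size_map ?size_iota //.
  by move: jt; rewrite mem_iota; lia.
by rewrite map_inj_in_uniq ?iota_uniq.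
Qed.

End Grafting.

Lemma eval_graft (k : fieldType) (B : algType k) phi (P : tree lp_sig) f :
  @eval k B phi (graft P f) = eval (fun _ j => eval phi (f j)) P.
Proof. by elim: P => //= g s -> u ->. Qed.

Section Rewriting.
Implicit Types (P q s t u : tree lp_sig) (f : nat -> tree lp_sig).

Definition lowerb q P : bool :=
  has (fun j =>
    all (fun i => (i < j)%N ==> (path_word i q == path_word i P)) (iota 1 3)
    && word_ltb (path_word j q) (path_word j P)) (iota 1 3).

Definition replaces q P : bool :=
  [&& well_coloured q, increasing q, out q == out P,
      min_label q == min_label P, perm_eq (leaves q) (leaves P) & lowerb q P].

(** A computable sufficient condition, free of [le]: every other term can take the place of [P] in
    any context and makes the tree smaller there. *)
Definition is_lead (r : seq (bool * tree lp_sig)) P : bool :=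
  [&& uniq (map snd r), perm_eq (labels P) (iota 1 3), P \in map snd r &
      all (fun p => (p.2 == P) || replaces p.2 P) r].

(** Increasing smallest labels ensure that the occurrence standardizes to [P] itself, and that a
    tree which is a shuffle tree before grafting remains one afterwards. *)
Definition graftable P f : Prop :=
  [/\ colour_compatible P f, perm_eq (labels P) (iota 1 3),
      {in iota 1 3, forall j, well_coloured (f j) && increasing (f j)},
      {in iota 1 3 &, {mono (fun j => min_label (f j)) : i j / (i <= j)%N}} &
      uniq (labels (graft P f))].

Lemma graftable_disjoint P f i j j' : graftable P f ->
  j \in iota 1 3 -> j' \in iota 1 3 ->
  i \in labels (f j) -> i \in labels (f j') -> j = j'.
Proof.
case=> _ pP _ _; rewrite labels_graft (perm_uniq (perm_flatten (perm_map _ pP))).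
rewrite /= cats0 !cat_uniq has_cat negb_or.
case/and3P=> _ /andP[/hasPn d12 /hasPn d13] /and3P[_ /hasPn d23 _].
have D12 : i \in labels (f 1%N) -> i \in labels (f 2%N) -> False.
  by move=> h1 /d12; rewrite /= h1.
have D13 : i \in labels (f 1%N) -> i \in labels (f 3%N) -> False.
  by move=> h1 /d13; rewrite /= h1.
have D23 : i \in labels (f 2%N) -> i \in labels (f 3%N) -> False.
  by move=> h1 /d23; rewrite /= h1.
rewrite !inE => /or3P[] /eqP -> /or3P[] /eqP -> //; tauto.
Qed.

Lemma graft_path_word P q f i j : graftable P f -> perm_eq (labels q) (iota 1 3) ->
  j \in iota 1 3 -> i \in labels (f j) ->
  path_word i (graft q f) = path_word j q ++ path_word i (f j).
Proof.
move=> gP pq jP ij; apply: path_word_graft => //; first by rewrite (perm_mem pq).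
move=> j'; rewrite (perm_mem pq) => j'P ij'.
exact: (graftable_disjoint gP j'P jP ij' ij).
Qed.

Lemma graft_replace q P f : replaces q P -> graftable P f ->
  [/\ well_coloured (graft q f), increasing (graft q f),
      out (graft q f) = out (graft P f),
      min_label (graft q f) = min_label (graft P f) &
      perm_eq (leaves (graft q f)) (leaves (graft P f))] /\
  lower (graft q f) (graft P f).
Proof.
case/and5P=> wq iq /eqP oq /eqP mq /andP[pq lq] gP.
have [cP pP wif mono _] := gP.
have cq : colour_compatible q f by rewrite /colour_compatible (perm_all _ pq).
have plq : perm_eq (labels q) (iota 1 3).
  by apply: perm_trans pP; apply: perm_map.
split.
  split.
  - by rewrite well_coloured_graft // => j; rewrite (perm_mem plq) => /wif/andP[].
  - apply: increasing_graft.
      rewrite increasing_relabel // => i j.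
      by rewrite !(perm_mem plq); apply: mono.
    by move=> j; rewrite (perm_mem plq) => /wif/andP[].
  - by rewrite !out_graft.
  - rewrite !min_label_graft !min_label_relabel ?mq // => i j.
      by rewrite !(perm_mem pP); apply: mono.
    by rewrite !(perm_mem plq); apply: mono.
  - by rewrite !leaves_graft; apply/perm_flatten/perm_map/perm_map.
case/hasP: lq => j jI /andP[/allP low lt].
(* The smallest label of the branch at the deciding leaf [j] is the witness: any smaller label lies
   in the branch at some leaf before [j], where the path words agree. *)
exists (min_label (f j)); split.
- rewrite labels_graft; apply/flattenP; exists (labels (f j)).
    by apply/map_f; rewrite (perm_mem pP).
  exact: min_label_in.
- move=> i; rewrite labels_graft => /flattenP[_ /mapP[j' + ->] ij'].
  rewrite (perm_mem pP) => j'I lti.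
  rewrite (graft_path_word gP plq j'I ij') (graft_path_word gP pP j'I ij').
  congr (_ ++ _); apply/eqP; apply: (implyP (low _ j'I)).
  rewrite ltnNge -(mono _ _ jI j'I) -ltnNge.
  exact: leq_ltn_trans (min_label_le ij') lti.
- rewrite (graft_path_word gP plq jI (min_label_in _)).
  rewrite (graft_path_word gP pP jI (min_label_in _)).
  exact: (word_ltb_cat [::]).
Qed.

Section Step.
Variables (k : fieldType) (B : algType k).

(** Equality is asked after evaluation only. Output colour, smallest label and leaves are kept
    because the surrounding vertices see them. *)
Definition rewrites t (l : seq (bool * tree lp_sig)) : Prop :=
  (forall phi, @eval k B phi t = \sum_(p <- l) (-1) ^+ p.1 *: eval phi p.2) /\
  {in l, forall p, [/\ well_coloured p.2, increasing p.2, out p.2 = out t,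
      min_label p.2 = min_label t & perm_eq (leaves p.2) (leaves t)] /\
      lower p.2 t}.

Lemma graft_rewrites r P f : r \in shuffle_relations -> is_lead r P ->
  graftable P f -> exists l, rewrites (graft P f) l.
Proof.
move=> rr /and4P[ur pP /mapP[p0 p0r EP] /allP rep] gP.
(* Solving the relation for [P] negates the other terms and divides by the sign of [P]. *)
exists [seq (~~ (p0.1 (+) p.1), graft p.2 f) | p <- r & p.2 != P]; split; last first.
  move=> _ /mapP[p + ->]; rewrite mem_filter => /andP[pP' pr] /=.
  by have := rep _ pr; rewrite (negbTE pP') => H; apply: graft_replace.
move=> phi; have := shuffle_relations_eval (fun _ j => eval phi (f j)) rr.
rewrite (bigD1_seq p0) ?(map_uniq ur) //= big_map big_filter -EP -eval_graft.
move/(congr1 (fun x => (-1) ^+ p0.1 *: x)).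
rewrite scalerDr scalerA -signr_addb addbb expr0 scale1r scaler0.
move/eqP; rewrite addr_eq0 => /eqP ->; rewrite -scaleN1r !scaler_sumr.
rewrite big_seq_cond [RHS]big_seq_cond; apply: eq_big => [p|p _]; last first.
  rewrite -eval_graft !scalerA; congr (_ *: _).
  by case: p0.1 => /=; case: p.1; rewrite /= ?expr1 ?expr0 ?mulr1 ?mul1r ?mulrNN ?mulr1.
case pr : (p \in r) => //=.
have [->|ne] := eqVneq p p0; first by rewrite -EP eqxx.
symmetry; apply/eqP => E; case/eqP: ne.
by apply: (uniq_map_inj ur) => //; rewrite E.
Qed.

End Step.

(* [redex g s u] says that the two vertices at the root of [Node g s u] (for a
   suitable second vertex) form the leading term of a relation. *)
Definition is_product t :=
  match t with Node Ga _ _ | Node Gb _ _ => true | _ => false end.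

Definition redex (g : lp_gen) s u : bool :=
  match g with
  | Beta => if s is Node Beta _ y then (min_label y < min_label u)%N else false
  | Ga => is_product u || (if s is Node Gb _ _ then true else false)
  | Gb => is_product u
  | Gd => is_product u || (if s is Node Beta _ _ then true else false)
  | Ge => is_product s ||
          (if s is Node Ge _ y then (min_label y < min_label u)%N else false)
  end.

Fixpoint normal t : bool :=
  match t with
  | Leaf _ _ => true
  | Node g s u => [&& ~~ redex g s u, normal s & normal u]
  end.

Definition good t := [&& well_coloured t, increasing t & uniq (labels t)].

Lemma goodP g s u : good (Node g s u) ->
  [/\ out s = src1 g, out u = src2 g, (min_label s < min_label u)%N &
      [/\ good s, good u & {in labels u, forall i, i \notin labels s}]].
Proof.
case/and3P=> /= /and4P[/eqP -> /eqP -> ws wu] /and3P[-> is_ iu].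
rewrite labels_node cat_uniq => /and3P[us /hasPn dis uu].
by rewrite /good ws wu is_ iu us uu.
Qed.

Definition lead_tree P : bool := has (fun r => is_lead r P) shuffle_relations.

Definition args3 x y z : nat -> tree lp_sig :=
  fun j => match j with 1%N => x | 2%N => y | _ => z end.

Local Notation leaf c j := (@Leaf lp_sig c j%N).

Lemma args3_graftable P x y z : perm_eq (labels P) (iota 1 3) ->
  colour_compatible P (args3 x y z) -> good (graft P (args3 x y z)) ->
  good x -> good y -> good z ->
  (min_label x < min_label y)%N -> (min_label y < min_label z)%N ->
  graftable P (args3 x y z).
Proof.
move=> pP cP /and3P[_ _ uP] /and3P[wx ix _] /and3P[wy iy _] /and3P[wz iz _].
move=> xy yz; split=> //.
  by move=> j; rewrite !inE => /or3P[] /eqP -> /=; apply/andP.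
by move=> i j; rewrite !inE => /or3P[] /eqP -> /or3P[] /eqP -> /=; lia.
Qed.

(** For a left-nested pair, the branch [u] competes with the right branch [y] of the child, giving
    the pattern ((1,2),3) or ((1,3),2); for a right-nested pair the shuffle condition leaves only
    (1,(2,3)). *)
Lemma redex_graft g s u : good (Node g s u) -> redex g s u ->
  exists P f, [/\ lead_tree P, graftable P f & Node g s u = graft P f].
Proof.
move=> gt; have [os ou su [gs gu dis]] := goodP gt.
pose G := exists P f, [/\ lead_tree P, graftable P f & Node g s u = graft P f].
have left2 h x y : s = Node h x y -> (min_label y < min_label u)%N ->
    lead_tree (Node g (Node h (leaf (src1 h) 1) (leaf (src2 h) 2)) (leaf (src2 g) 3)) ->
  G.
  move=> Es yu lP; set P := Node g _ _ in lP; rewrite /G; exists P, (args3 x y u).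
  rewrite Es in gt gs *; have [ox oy xy [gx gy _]] := goodP gs.
  split=> //; apply: args3_graftable => //.
  by rewrite /colour_compatible /= ox oy ou !eqxx.
have left3 h x y : s = Node h x y -> (min_label u < min_label y)%N ->
    lead_tree (Node g (Node h (leaf (src1 h) 1) (leaf (src2 h) 3)) (leaf (src2 g) 2)) ->
  G.
  move=> Es uy lP; set P := Node g _ _ in lP; rewrite /G; exists P, (args3 x u y).
  rewrite Es in gt gs su *; have [ox oy xy [gx gy _]] := goodP gs.
  split=> //; apply: args3_graftable => //.
    by rewrite /colour_compatible /= ox oy ou !eqxx.
  by move: su; rewrite /= /minn; case: ifP; lia.
have right h y z : u = Node h y z ->
    lead_tree (Node g (leaf (src1 g) 1) (Node h (leaf (src1 h) 2) (leaf (src2 h) 3))) ->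
  G.
  move=> Eu lP; set P := Node g _ _ in lP; rewrite /G; exists P, (args3 s y z).
  rewrite Eu in gt gu su *; have [oy oz yz [gy gz _]] := goodP gu.
  split=> //; apply: args3_graftable => //.
    by rewrite /colour_compatible /= oy oz os !eqxx.
  by move: su; rewrite /= /minn; case: ifP; lia.
have left h x y : s = Node h x y ->
    lead_tree (Node g (Node h (leaf (src1 h) 1) (leaf (src2 h) 2)) (leaf (src2 g) 3)) ->
    lead_tree (Node g (Node h (leaf (src1 h) 1) (leaf (src2 h) 3)) (leaf (src2 g) 2)) ->
  G.
  move=> Es l2 l3; case: (ltngtP (min_label y) (min_label u)) => [yu|uy|E].
  - exact: left2 Es yu l2.
  - exact: left3 Es uy l3.
  - have := dis _ (min_label_in u).
    by rewrite -E Es labels_node mem_cat min_label_in orbT.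
rewrite -/G => rd; clearbody G; clear gt os ou; move: rd.
case: g left2 left3 right left => left2 left3 right left /=.
- case Es: s => [//|[] x y] // yu.
  by apply: left2 Es yu _; vm_compute.
- case/orP=> [|].
    by case Eu: u => [//|[] x y] // _; apply: right Eu _; vm_compute.
  by case Es: s => [//|[] x y] // _; apply: left Es _ _; vm_compute.
- by case Eu: u => [//|[] x y] // _; apply: right Eu _; vm_compute.
- case/orP=> [|].
    by case Eu: u => [//|[] x y] // _; apply: right Eu _; vm_compute.
  by case Es: s => [//|[] x y] // _; apply: left Es _ _; vm_compute.
- case/orP=> [|].
    by case Es: s => [//|[] x y] // _; apply: left Es _ _; vm_compute.
  case Es: s => [//|[] x y] // yu.
  by apply: left2 Es yu _; vm_compute.
Qed.

Lemma divides_lead t : good t -> ~~ normal t ->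
  exists r P, [/\ r \in shuffle_relations, is_lead r P & divides P t].
Proof.
move=> gt nt; suff [P [f [lP gP bP]]] : exists P f,
    [/\ lead_tree P, graftable P f & graft P f \in branches t].
  have /hasP[r rr rP] := lP; exists r, P; split=> //.
  have [cP pP _ mono _] := gP; apply/hasP; exists (graft P f) => //.
  apply/mapP; exists (relabel (fun j => min_label (f j)) P); last first.
    by rewrite (standardize_relabel pP mono).
  by rewrite -graft_relabel // prunings_graft.
elim: t gt nt => [c j|g s IHs u IHu] //= gt.
have [_ _ _ [gs gu _]] := goodP gt.
rewrite !negb_and negbK => /or3P[rd|ns|nu].
- have [P [f [lP gP E]]] := redex_graft gt rd; exists P, f; split=> //.
  by rewrite -E inE eqxx.
- have [P [f [lP gP E]]] := IHs gs ns; exists P, f; split=> //.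
  by rewrite inE mem_cat E orbT.
- have [P [f [lP gP E]]] := IHu gu nu; exists P, f; split=> //.
  by rewrite inE mem_cat E !orbT.
Qed.

Section NormalForm.
Variables (k : fieldType) (B : algType k).

(** Operations are linear in each branch and [lower] is stable under adding vertices below, so a
    step at any vertex extends to the whole tree. *)
Lemma not_normal_rewrites t : good t -> ~~ normal t ->
  exists l, @rewrites k B t l.
Proof.
elim: t => [c j|g s IHs u IHu] //= gt.
have [os ou su [gs gu dis]] := goodP gt.
have /and3P[/= /and4P[_ _ ws wu] /and3P[_ is_ iu] _] := gt.
rewrite !negb_and negbK => /or3P[rd|ns|nu].
- have [P [f [/hasP[r rr lP] gP E]]] := redex_graft gt rd.
  by rewrite E; apply: (graft_rewrites B rr lP gP).
- have [l [El Hl]] := IHs gs ns.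
  exists [seq (p.1, Node g p.2 u) | p <- l]; split=> [phi|_ /mapP[p pl ->] /=].
    pose op := GRing.isLinear.Build k B B _ (gen_op g ^~ (eval phi u))
       (gen_op_linear_l g (eval phi u)).
    pose opl : {linear B -> B} := HB.pack (gen_op g ^~ (eval phi u)) op.
    rewrite big_map /= El -[LHS]/(opl _) linear_sum.
    by apply: eq_bigr => p _; rewrite linearZ.
  have [[w i o m p_] lo] := Hl p pl.
  rewrite w i o m os ou !eqxx wu iu su; split.
    by split=> //; rewrite perm_cat2r.
  apply: lower_left => //; apply: perm_mem; exact: perm_map.
- have [l [El Hl]] := IHu gu nu.
  exists [seq (p.1, Node g s p.2) | p <- l]; split=> [phi|_ /mapP[p pl ->] /=].
    pose op := GRing.isLinear.Build k B B _ (gen_op g (eval phi s))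
       (gen_op_linear_r g (eval phi s)).
    pose opl : {linear B -> B} := HB.pack (gen_op g (eval phi s)) op.
    rewrite big_map /= El -[LHS]/(opl _) linear_sum.
    by apply: eq_bigr => p _; rewrite linearZ.
  have [[w i o m p_] lo] := Hl p pl.
  rewrite w i o m os ou !eqxx ws is_ su; split.
    by split=> //; rewrite perm_cat2l.
  apply: lower_right => //; apply: perm_mem; exact: perm_map.
Qed.

End NormalForm.
End Rewriting.

(** * Lowest words of evaluations and linear independence *)

Section WordOrder.
Implicit Types u v w : seq int.

Definition wle u v : bool := ((u : seqlexi int) <= (v : seqlexi int))%O.

Lemma wle_refl w : wle w w.
Proof. exact: le_refl. Qed.

Lemma wle_anti u v : wle u v -> wle v u -> u = v.
Proof. by move=> uv vu; apply: (@le_anti _ (seqlexi int)); apply/andP. Qed.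

Lemma wle_trans v u w : wle u v -> wle v w -> wle u w.
Proof. exact: le_trans. Qed.

Lemma wle_total u v : wle u v || wle v u.
Proof. exact: le_total. Qed.

Lemma wle_cons (x y : int) u v :
  wle (x :: u) (y :: v) = (x <= y) && ((y <= x) ==> wle u v).
Proof. exact: lexi_cons. Qed.

Lemma wle_cat u u' v v' : size u = size u' ->
  wle u u' -> wle v v' -> wle (u ++ v) (u' ++ v').
Proof.
move=> + + vv'; elim: u u' => [|x u IHu] [|y u'] //= [su].
rewrite !wle_cons => /andP[-> /= /implyP H]; apply/implyP => /H.
exact: IHu.
Qed.

(** Equal lengths are demanded because they make the lexicographic order compatible with
    concatenation; a single occurrence excludes cancellation. *)
Definition lowest (l : seq (bool * seq int)) w : bool :=
  all (fun p => (size p.2 == size w) && wle w p.2) l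
  && (count (fun p => p.2 == w) l == 1%N).

Definition mulw (l l' : seq (bool * seq int)) :=
  [seq (p.1 (+) q.1, p.2 ++ q.2) | p <- l, q <- l'].

Definition oppw (l : seq (bool * seq int)) := [seq (~~ p.1, p.2) | p <- l].

Lemma lowest_all l w p : lowest l w -> p \in l -> size p.2 = size w /\ wle w p.2.
Proof. by case/andP=> /allP H _ /H /andP[/eqP]. Qed.

(** All words of [l] have the same length, so [w ++ w'] splits in one way only and its multiplicity
    is the product of the two multiplicities. *)
Lemma lowest_mulw l l' w w' : lowest l w -> lowest l' w' ->
  lowest (mulw l l') (w ++ w').
Proof.
move=> lw lw'; have /andP[_ /eqP c] := lw; have /andP[_ /eqP c'] := lw'.
apply/andP; split.
  apply/allP => _ /allpairsP[[p q] [/= pl ql ->]] /=.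
  have [sp wp] := lowest_all lw pl; have [sq wq] := lowest_all lw' ql.
  by rewrite !size_cat sp sq eqxx wle_cat.
have /allP szl : all (fun p => size p.2 == size w) l.
  by apply/allP => p /(lowest_all lw)[/eqP].
rewrite -{}c' -[X in _ == X]mul1n -{}c {lw lw'}.
apply/eqP; rewrite /mulw; elim: l szl => [|p l IHl] //= szl.
rewrite count_cat IHl => [|q ql]; last by apply: szl; rewrite inE ql orbT.
rewrite mulnDl count_map; congr (_ + _)%N.
have /eqP sp := szl p (mem_head _ _).
have [E|ne] := eqVneq p.2 w; rewrite ?mul1n ?mul0n.
  by apply: eq_count => q /=; rewrite E eqseq_cat // eqxx.
rewrite -(count_pred0 l'); apply: eq_count => q /=.
by rewrite eqseq_cat // (negbTE ne).
Qed.

Lemma lowest_oppw l w : lowest (oppw l) w = lowest l w.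
Proof. by rewrite /lowest all_map count_map. Qed.

Lemma lowest_catC l l' w : lowest (l ++ l') w = lowest (l' ++ l) w.
Proof. by rewrite /lowest !all_cat andbC !count_cat addnC [all _ l && _]andbC andbC. Qed.

Lemma lowest_cat l l' w w' : lowest l w -> lowest l' w' ->
  size w = size w' -> wle w w' -> w != w' -> lowest (l ++ l') w.
Proof.
move=> lw lw' sw ww' ne; have /andP[al c] := lw.
rewrite /lowest all_cat count_cat al.
rewrite (_ : count _ l' = 0%N) ?addn0 ?c ?andbT.
  apply/allP => p /(lowest_all lw')[-> w'p].
  by rewrite sw eqxx (wle_trans ww').
apply/eqP; rewrite -leqn0 leqNgt -has_count; apply/hasPn => p pl'.
have [_ w'p] := lowest_all lw' pl'; apply/eqP => E.
by case/eqP: ne; apply: wle_anti => //; rewrite -E.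
Qed.

End WordOrder.

(** Negative integers put the letters of colour A below those of colour L. *)
Definition letter (c : lp_colour) (j : nat) : int :=
  if c is colA then Negz j else Posz j.

Definition label_of (x : int) : nat :=
  match x with Posz j => j | Negz j => j end.

Definition isA (x : int) : bool := if x is Negz _ then true else false.

Section LeadingWord.
Implicit Types s t u : tree lp_sig.

Fixpoint expand t : seq (bool * seq int) :=
  match t with
  | Leaf c j => [:: (false, [:: letter c j])]
  | Node g s u =>
      let: x := expand s in let: y := expand u in
      match g : lp_gen with
      | Beta | Gd => mulw x y ++ oppw (mulw y x)
      | Ga => mulw x y
      | Gb => mulw y x
      | Ge => mulw y x ++ oppw (mulw x y)
      end
  end.

(* The smallest word in [expand t]: a word of colour L begins with its smallest
   label, a word of colour A with a letter of colour A. *)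
Fixpoint lead t : seq int :=
  match t with
  | Leaf c j => [:: letter c j]
  | Node g s u =>
      match g : lp_gen with
      | Beta | Ga | Ge => lead s ++ lead u
      | Gb | Gd => lead u ++ lead s
      end
  end.

Lemma letter_inj c c' j j' : letter c j = letter c' j' -> (c, j) = (c', j').
Proof. by case: c; case: c' => //= -[->]. Qed.

Lemma label_letter c j : label_of (letter c j) = j.
Proof. by case: c. Qed.

Lemma perm_lead_labels t : perm_eq (map label_of (lead t)) (labels t).
Proof.
elim: t => [c j|g s IHs u IHu]; first by rewrite /= label_letter.
rewrite labels_node.
by case: g; rewrite /= map_cat;
  first [exact: perm_cat | rewrite perm_catC; exact: perm_cat].
Qed.

Lemma colL_lead t : good t -> out t = colL ->
  ~~ has isA (lead t) /\ exists v, lead t = Posz (min_label t) :: v.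
Proof.
elim: t => [c j|g s IHs u IHu] gt; first by move=> /= ->; split=> //; exists [::].
have [os ou su [gs gu _]] := goodP gt.
case: g os ou {gt} => //= os ou _.
have [hs [v Ev]] := IHs gs os; have [hu _] := IHu gu ou.
split; first by rewrite has_cat negb_or hs.
exists (v ++ lead u); rewrite Ev /=; congr (Posz _ :: _).
by rewrite /minn su.
Qed.

Lemma colA_lead t : good t -> out t = colA -> exists j v, lead t = Negz j :: v.
Proof.
elim: t => [c j|g s IHs u IHu] gt; first by move=> /= ->; exists j, [::].
have [os ou su [gs gu _]] := goodP gt.
case: g os ou {gt} => //= os ou _.
- by have [j [v ->]] := IHs gs os; exists j, (v ++ lead u).
- by have [j [v ->]] := IHu gu ou; exists j, (v ++ lead s).
- by have [j [v ->]] := IHu gu ou; exists j, (v ++ lead s).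
- by have [j [v ->]] := IHs gs os; exists j, (v ++ lead u).
Qed.

(** The lowest words of the two products in a commutator differ at their first letter: for [Beta]
    these are the smallest labels of the branches, for [Gd] and [Ge] a letter of colour A faces one
    of colour L. *)
Lemma lowest_expand t : good t -> lowest (expand t) (lead t).
Proof.
elim: t => [c j|g s IHs u IHu] gt; first by rewrite /lowest /= wle_refl !eqxx.
have [os ou su [gs gu _]] := goodP gt.
have {IHs} ls := IHs gs; have {IHu} lu := IHu gu.
have lsu := lowest_mulw ls lu; have lus := lowest_mulw lu ls.
have szC : size (lead s ++ lead u) = size (lead u ++ lead s).
  by rewrite !size_cat addnC.
case: g os ou {gt} => //= os ou.
- have [_ [v Ev]] := colL_lead gs os; have [_ [v' Ev']] := colL_lead gu ou.
  apply: lowest_cat lsu _ szC _ _; rewrite ?lowest_oppw //.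
    by rewrite Ev Ev' wle_cons; apply/andP; split; [|apply/implyP]; lia.
  by rewrite Ev Ev'; apply/eqP => -[E]; rewrite E ltnn in su.
- have [_ [v Ev]] := colL_lead gs os; have [j [v' Ev']] := colA_lead gu ou.
  rewrite lowest_catC; apply: lowest_cat lsu _ _ _; rewrite ?lowest_oppw //.
    by rewrite Ev Ev' wle_cons.
  by rewrite Ev Ev'.
- have [j [v Ev]] := colA_lead gs os; have [_ [v' Ev']] := colL_lead gu ou.
  rewrite lowest_catC; apply: lowest_cat lus _ _ _; rewrite ?lowest_oppw //.
    by rewrite Ev Ev' wle_cons.
  by rewrite Ev Ev'.
Qed.

Section FreeAlgebra.
Variable k : fieldType.

Local Notation B := (free_algebra k int).

Definition generic (c : lp_colour) (j : nat) : B :=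
  << FMonom [:: letter c j] >>.

Lemma malg_mulU (u v : seq int) :
  << FMonom u >> * << FMonom v >> = << FMonom (u ++ v) >> :> B.
Proof. by rewrite malgM_def fgmulUU mulr1 /mmul /= fmmulE. Qed.

Definition word_sum (l : seq (bool * seq int)) : B :=
  \sum_(p <- l) (-1) ^+ p.1 *: << FMonom p.2 >>.

Lemma word_sum_cat l l' : word_sum (l ++ l') = word_sum l + word_sum l'.
Proof. exact: big_cat. Qed.

Lemma word_sum_opp l : word_sum (oppw l) = - word_sum l.
Proof.
rewrite /word_sum big_map -sumrN; apply: eq_bigr => p _ /=.
by rewrite signrN scaleNr.
Qed.

Lemma word_sum_mul l l' : word_sum (mulw l l') = word_sum l * word_sum l'.
Proof.
rewrite /word_sum mulr_suml big_allpairs_dep; apply: eq_bigr => p _.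
rewrite mulr_sumr; apply: eq_bigr => q _ /=.
by rewrite -scalerAl -scalerAr scalerA -signr_addb malg_mulU.
Qed.

Lemma eval_generic t : eval generic t = word_sum (expand t).
Proof.
elim: t => [c j|g s IHs u IHu] /=.
  by rewrite /word_sum big_seq1 /= expr0 scale1r.
by case: g; rewrite /= IHs IHu ?word_sum_cat ?word_sum_opp !word_sum_mul.
Qed.

Lemma mcoeff_word_sum l w :
  (word_sum l)@_(FMonom w) = \sum_(p <- l) (-1) ^+ p.1 *+ (p.2 == w).
Proof.
rewrite /word_sum raddf_sum /=; apply: eq_bigr => p _.
by rewrite mcoeffZ mcoeffU mulrnAr mulr1.
Qed.

Lemma mcoeff_word_sum_lead l w : lowest l w -> (word_sum l)@_(FMonom w) != 0.
Proof.
case/andP=> _; rewrite mcoeff_word_sum.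
elim: l => [|p l IHl] //=; rewrite big_cons.
have [_|_] := eqVneq p.2 w; last by rewrite mulr0n add0r.
rewrite /= add1n eqSS => c0; rewrite mulr1n big_seq big1 ?addr0 ?signr_eq0 // => q ql.
case: eqP => [E|]; rewrite ?mulr0n //.
by move: c0; rewrite -leqn0 leqNgt -has_count; case/hasP; exists q => //; apply/eqP.
Qed.

Lemma mcoeff_word_sum_wle l w w' : lowest l w ->
  (word_sum l)@_(FMonom w') != 0 -> wle w w'.
Proof.
move=> lw; apply: contraR => nw; rewrite mcoeff_word_sum big_seq big1 // => p pl.
case: eqP => [E|]; rewrite ?mulr0n //.
by have [_] := lowest_all lw pl; rewrite E (negbTE nw).
Qed.

(** Triangularity: among the trees with nonzero coefficient, the one with smallest [lead] is alone
    in producing that word. *)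
Lemma eval_independent (s : seq (tree lp_sig)) (c : tree lp_sig -> k) :
  uniq s -> {in s, forall t, good t} -> {in s &, injective lead} ->
  \sum_(t <- s) c t *: eval generic t = 0 -> {in s, forall t, c t = 0}.
Proof.
move=> us gs inj E t ts; apply/eqP; apply/negPn/negP => ct.
pose s' := [seq x <- s | c x != 0].
have [m [ms' mmin]] : exists m, m \in s' /\ {in s', forall x, wle (lead m) (lead x)}.
  have : t \in s' by rewrite mem_filter ct.
  elim: s' t {ts ct} => [|x s' IHs] t //= _.
  case: s' IHs => [|y s'] IHs.
    by exists x; split=> [|z]; rewrite inE // => /eqP ->; apply: wle_refl.
  have [m [ms mm]] := IHs y (mem_head _ _).
  have [xm|mx] := orP (wle_total (lead x) (lead m)).
    exists x; split=> [|z]; first exact: mem_head.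
    rewrite inE => /predU1P[->|/mm]; first exact: wle_refl.
    exact: wle_trans.
  exists m; split=> [|z]; first by rewrite inE ms orbT.
  by rewrite inE => /predU1P[->|/mm].
move: ms'; rewrite mem_filter => /andP[cm ms].
move/(congr1 (fun x => x@_(FMonom (lead m)))): E.
rewrite mcoeff0 raddf_sum /= (bigD1_seq m) //= mcoeffZ eval_generic.
rewrite big_seq_cond big1 ?addr0 => [|x /andP[xs xm]].
  apply/eqP; rewrite mulf_neq0 //; apply: mcoeff_word_sum_lead.
  exact/lowest_expand/gs.
rewrite mcoeffZ eval_generic; have [->|cx] := eqVneq (c x) 0; first by rewrite mul0r.
have [->|nz] := eqVneq ((word_sum (expand x))@_(FMonom (lead m))) 0.
  by rewrite mulr0.
have le1 := mcoeff_word_sum_wle (lowest_expand (gs x xs)) nz.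
have le2 : wle (lead m) (lead x) by apply: mmin; rewrite mem_filter cx.
by rewrite (inj x m xs ms (wle_anti le1 le2)) eqxx in xm.
Qed.

End FreeAlgebra.
End LeadingWord.

(** * Recovering a normal tree from its leading word *)

Section Decoding.
Implicit Types s t u : tree lp_sig.

Definition labs t := map label_of (lead t).

Lemma labs_perm t : perm_eq (labs t) (labels t).
Proof. exact: perm_lead_labels. Qed.

(* The labels following the smallest one in the leading word. *)
Definition after t := drop (index (min_label t) (labs t)).+1 (labs t).

Lemma after_cat s u (r : seq nat) m : m \in labs s ->
  drop (index m (labs s ++ r)).+1 (labs s ++ r) =
  drop (index m (labs s)).+1 (labs s) ++ r.
Proof.
move=> ms; rewrite index_cat ms drop_cat.
have := ms; rewrite -index_mem leq_eqVlt => /orP[/eqP E|lt]; last by rewrite lt.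
by rewrite E ltnn subnn drop0 drop_size.
Qed.

Lemma min_label_labs t : min_label t \in labs t.
Proof. by rewrite (perm_mem (labs_perm t)) min_label_in. Qed.

Lemma isA_lead t : good t -> out t = colL -> count isA (lead t) = 0%N.
Proof.
by move=> gt /(colL_lead gt)[h _]; apply/eqP; rewrite -leqn0 leqNgt -has_count.
Qed.

(** Normality forbids a product as the A argument of [Gd] or [Ge], so a single leaf has colour A,
    and [lead] puts its branch first at each vertex. *)
Lemma block_lead t : good t -> normal t -> out t = colA -> ~~ is_product t ->
  exists j v, lead t = Negz j :: v /\ ~~ has isA v.
Proof.
elim: t => [c j|g s IHs u IHu] gt; first by move=> _ /= -> _; exists j, [::].
have [os ou su [gs gu _]] := goodP gt.
move=> /= /and3P[rd ns nu]; case: g os ou rd {gt} => //= os ou rd _ _.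
- have nup : ~~ is_product u by move: rd; case: is_product.
  have [j [v [Ev hv]]] := IHu gu nu ou nup.
  exists j, (v ++ lead s); rewrite Ev has_cat (negbTE hv); split=> //.
  by have [] := colL_lead gs os.
- have nsp : ~~ is_product s by move: rd; case: is_product.
  have [j [v [Ev hv]]] := IHs gs ns os nsp.
  exists j, (v ++ lead u); rewrite Ev has_cat (negbTE hv); split=> //.
  by have [] := colL_lead gu ou.
Qed.

(** The first letter is skipped in the search and counted back by the successor: the cut falls just
    before the second letter of colour A. *)
Definition first_block (w : seq int) := take (find isA (behead w)).+1 w.

Lemma first_block_cat j v r : ~~ has isA v -> (r == [::]) || isA (head 0 r) ->
  first_block ((Negz j :: v) ++ r) = Negz j :: v.
Proof.
move=> hv hr; rewrite /first_block /= find_cat (negbTE hv); congr (_ :: _).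
have -> : find isA r = 0%N by case: r hr => //= x r ->.
by rewrite addn0 take_size_cat.
Qed.

(** A normal [Ga] has no [Gb] as left child, so going left through [Ga] vertices ends at a block,
    and the smallest label always lies on the left. The word [r] collects the right factors passed
    on the way. *)
Lemma min_in_first_block t r : good t -> normal t -> out t = colA ->
  (if t is Node Gb _ _ then false else true) ->
  (r == [::]) || isA (head 0 r) ->
  min_label t \in map label_of (first_block (lead t ++ r)).
Proof.
have block t' r' : good t' -> normal t' -> out t' = colA -> ~~ is_product t' ->
    (r' == [::]) || isA (head 0 r') ->
    min_label t' \in map label_of (first_block (lead t' ++ r')).
  move=> gt nt ot pt hr; have [j [v [E hv]]] := block_lead gt nt ot pt.
  by have := min_label_labs t'; rewrite /labs E first_block_cat.
elim: t r => [c j|g s IHs u IHu] r gt nt ot nb hr; first exact: block.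
case: g gt nt ot nb => gt nt ot nb //; try exact: block.
have [os ou su [gs gu _]] := goodP gt; have /= /and3P[rd ns nu] := nt.
rewrite /= -catA /minn su; apply: IHs => //.
  by move: rd; rewrite /= negb_or => /andP[_]; case: (s) => // -[].
by have [j [v ->]] := colA_lead gu ou.
Qed.

Lemma after_node g s u : good (Node g s u) -> g \in [:: Beta; Ge] ->
  after (Node g s u) = after s ++ labs u.
Proof.
move=> gt; have [os ou su _] := goodP gt.
rewrite !inE /after /labs => /orP[] /eqP -> /=; rewrite map_cat /minn su;
  by apply: after_cat => //; apply: min_label_labs.
Qed.

(** If [s] is [Node h x y] with [h] equal to [g], normality gives [min_label u < min_label y], and
    by induction the labels of [after x] exceed [min_label y]. *)
Lemma after_lt g s u : good (Node g s u) -> normal (Node g s u) ->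
  g \in [:: Beta; Ge] -> {in after s, forall j, (min_label u < j)%N}.
Proof.
elim: s g u => [c j|h x IHx y _] g u gt nt gE i.
  by rewrite /after drop_oversize.
have [os ou su [gs gu dis]] := goodP gt; have /= /and3P[rd ns nu] := nt.
have [ox oy xy [gx gy disx]] := goodP gs.
have ne : min_label y != min_label u.
  apply/eqP => E; have := dis _ (min_label_in u).
  by rewrite -E labels_node mem_cat min_label_in orbT.
have last2 : g = h -> h \in [:: Beta; Ge] -> (min_label u < min_label y)%N ->
    i \in after (Node h x y) -> (min_label u < i)%N.
  move=> gh hE uy; rewrite after_node // mem_cat => /orP[ia|].
    exact: ltn_trans uy (IHx h y gs ns hE i ia).
  by rewrite (perm_mem (labs_perm y)) => /min_label_le; apply: leq_trans.
case: g gE rd os ou {gt nt} last2 => // _ rd os ou last2.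
  case: h os gs ns rd last2 ox oy su dis => // os gs ns rd last2 ox oy su dis.
  apply: last2 => //; move: rd ne; rewrite /=; lia.
case: h os gs ns rd last2 ox oy su dis => // os gs ns rd last2 ox oy su dis; last first.
  apply: last2 => //; move: rd ne; rewrite /=; lia.
(* With root [Gd], normality makes the left branch a leaf; its label is the smallest one and ends
   the word, so nothing comes after it. *)
have Ex : exists m, x = @Leaf lp_sig colL m.
  have /= /and3P[] := ns; rewrite negb_or => /andP[_].
  by case: (x) ox => [c m /= ->|[] ] //; exists m.
case: Ex => m Em; subst x.
rewrite /after /labs /= map_cat /= in xy *.
rewrite /minn xy index_cat.
have -> : m \in map label_of (lead y) = false.
  apply/negP; rewrite (perm_mem (perm_lead_labels y)) => /disx.
  by rewrite inE eqxx.
rewrite /= eqxx addn0 drop_oversize // size_cat size_map /= addn1.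
by [].
Qed.

(* In the leading word [w] of a normal tree with smallest label [m], a vertex
   Ge has [m] in its left factor and Gd has [m] as its last letter; at a vertex
   Ga or Gb the word is a product of blocks, each starting with its only letter of
   colour A, and [m] lies in the first block only for Ga. *)
Definition root_of (w : seq int) (m : nat) : lp_gen :=
  if count isA w == 0%N then Beta
  else if count isA w == 1%N then
    (if last 0%N (map label_of w) == m then Gd else Ge)
  else if m \in map label_of (first_block w) then Ga else Gb.

Lemma last_labs u : last 0%N (labs u) \in labels u.
Proof.
rewrite -(perm_mem (labs_perm u)); have := min_label_labs u.
by case: (labs u) => // x v _; apply: mem_last.
Qed.

Lemma last_cat_labs (v : seq nat) u : last 0%N (v ++ labs u) = last 0%N (labs u).
Proof.
by rewrite last_cat; have := min_label_labs u; case: (labs u).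
Qed.

Lemma count_isA_gt0 t : good t -> out t = colA -> (0 < count isA (lead t))%N.
Proof. by move=> gt /(colA_lead gt)[j [v ->]]. Qed.

Lemma count_isA_block t : good t -> normal t -> out t = colA ->
  ~~ is_product t -> count isA (lead t) = 1%N.
Proof.
move=> gt nt ot pt; have [j [v [-> hv]]] := block_lead gt nt ot pt.
by rewrite /= (_ : count _ _ = 0%N) //; apply/eqP; rewrite -leqn0 leqNgt -has_count.
Qed.

Lemma normal_Gd_leaf s u : good (@Node lp_sig Gd s u) ->
  normal (@Node lp_sig Gd s u) ->
  exists m, s = @Leaf lp_sig colL m.
Proof.
move=> gt; have [os _ _ _] := goodP gt.
case/and3P; rewrite /= negb_or => /andP[_].
by case: s os {gt} => [c m /= ->|[] //]; exists m.
Qed.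

Lemma root_ofE g s u : good (Node g s u) -> normal (Node g s u) ->
  root_of (lead (Node g s u)) (min_label (Node g s u)) = g.
Proof.
move=> gt nt; have [os ou su [gs gu dis]] := goodP gt.
have /= /and3P[rd ns nu] := nt.
have mu i : i \in labels u -> i != min_label s.
  by move=> /dis; apply: contra => /eqP ->; apply: min_label_in.
rewrite /root_of /minn; case: g gt nt os ou rd => gt nt os ou rd /=;
  rewrite /minn su count_cat.
- by rewrite !isA_lead.
- have := count_isA_gt0 gs os; have := count_isA_gt0 gu ou.
  have := @min_in_first_block _ [::] gt nt erefl isT isT.
  rewrite cats0 /= /minn su => ->.
  by case: (count isA (lead u)) => // a; case: (count isA (lead s)) => // b;
     rewrite addnS.
- have [j [v [Eu hv]]] := block_lead gu nu ou rd.
  have [j' [v' Es]] := colA_lead gs os.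
  have c2 : (0 < count isA (lead s))%N by apply: count_isA_gt0.
  have -> : first_block (lead u ++ lead s) = lead u.
    by rewrite Eu first_block_cat // Es orbT.
  have -> : (min_label s \in map label_of (lead u)) = false.
    rewrite (perm_mem (perm_lead_labels u)); apply/negP => /mu.
    by rewrite eqxx.
  by rewrite (count_isA_block gu nu ou rd); case: (count isA (lead s)) c2.
- have pu : ~~ is_product u by move: rd; rewrite negb_or => /andP[].
  rewrite (count_isA_block gu nu ou pu) (isA_lead gs os) /=.
  have [m ->] := normal_Gd_leaf gt nt.
  by rewrite map_cat last_cat /= eqxx.
- have ps : ~~ is_product s by move: rd; rewrite negb_or => /andP[].
  rewrite (count_isA_block gs ns os ps) (isA_lead gu ou) /=.
  rewrite map_cat -/(labs u) last_cat_labs.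
  by rewrite (negbTE (mu _ (last_labs u))).
Qed.

(* For Beta and Ge, normality makes all labels between [m] and the right factor
   larger than the first label of that factor, which is its smallest one. *)
Definition right_size (g : lp_gen) (w : seq int) (m : nat) : nat :=
  let: l := map label_of w in
  match g with
  | Beta | Ge =>
      let: a := drop (index m l).+1 l in size a - find (fun j => all (leq j) a) a
  | Ga => (find isA (rev w)).+1
  | Gb => (find isA (behead w)).+1
  | Gd => (size w).-1
  end.

Lemma right_sizeE g s u : good (Node g s u) -> normal (Node g s u) ->
  right_size g (lead (Node g s u)) (min_label (Node g s u)) = size (lead u).
Proof.
move=> gt nt; have [os ou su [gs gu dis]] := goodP gt.
have /= /and3P[rd ns nu] := nt.
have chain : g \in [:: Beta; Ge] -> out u = colL ->
    let: a := after (Node g s u) in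
    (size a - find (fun j => all (leq j) a) a)%N = size (lead u).
  move=> gE cu; have lt := after_lt gt nt gE.
  rewrite after_node //; set a := after s ++ labs u.
  have mua : min_label u \in a by rewrite mem_cat min_label_labs orbT.
  pose p j := all (leq j) a; rewrite -/p.
  (* Labels in [after s] exceed [min_label u], which belongs to [a]; hence none of them is a lower
     bound and the search passes over them. *)
  have fa : find p a = (size (after s) + find p (labs u))%N.
    rewrite find_cat ifN //; apply/hasPn => j /lt; rewrite ltnNge.
    by apply: contra => /allP; apply.
  have [_ [v Ev]] := colL_lead gu cu.
  have min_ok : p (min_label u).
    apply/allP => j; rewrite mem_cat => /orP[/lt/ltnW//|].
    by rewrite (perm_mem (labs_perm u)) => /min_label_le.
  have -> : find p a = size (after s).
    by rewrite fa /labs Ev /= min_ok addn0.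
  by rewrite size_cat addKn size_map.
case: g gt nt os ou rd chain => gt nt os ou rd chain.
- exact: chain.
- have up : ~~ is_product u by move: rd; rewrite negb_or => /andP[].
  have [j [v [-> hv]]] := block_lead gu nu ou up.
  by rewrite /= rev_cat rev_cons cat_rcons find_cat has_rev (negbTE hv) /= addn0 size_rev.
- have [j [v [-> hv]]] := block_lead gu nu ou rd.
  have [j' [v' ->]] := colA_lead gs os.
  by rewrite /= find_cat (negbTE hv) /= addn0.
- by have [m ->] := normal_Gd_leaf gt nt; rewrite /= size_cat addn1.
- exact: chain.
Qed.

(** The word determines the labels, hence the smallest one, hence the root and the length of the
    right factor; the two factors are then equal and induction applies. *)
Lemma lead_inj t t' : good t -> good t' -> normal t -> normal t' ->
  lead t = lead t' -> t = t'.
Proof.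
have lead_gt0 v : (0 < size (lead v))%N.
  by rewrite -(size_map label_of); have := min_label_labs v; rewrite /labs; case: map.
have size_node g s u : (1 < size (lead (Node g s u)))%N.
  by case: g; rewrite /= size_cat; have := lead_gt0 s; have := lead_gt0 u; lia.
elim: t t' => [c j|g s IHs u IHu] [c' j'|g' s' u'] gt gt' nt nt' E.
- by move: E => /= -[/letter_inj[-> ->]].
- by have := size_node g' s' u'; rewrite -E.
- by have := size_node g s u; rewrite E.
have Em : min_label (Node g s u) = min_label (Node g' s' u').
  apply/eqP; rewrite eqn_leq !min_label_le //.
    by rewrite -(perm_mem (labs_perm _)) /labs -E; apply: min_label_labs.
  by rewrite -(perm_mem (labs_perm _)) /labs E; apply: min_label_labs.
have Eg : g = g'.
  by rewrite -(root_ofE gt nt) E Em root_ofE.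
have su : size (lead u) = size (lead u').
  by rewrite -(right_sizeE gt nt) E Em Eg right_sizeE.
have [_ _ _ [gs gu _]] := goodP gt; have [_ _ _ [gs' gu' _]] := goodP gt'.
have /= /and3P[_ ns nu] := nt; have /= /and3P[_ ns' nu'] := nt'.
have ss : size (lead s) = size (lead s').
  have := congr1 size E; rewrite -Eg.
  case: (g); rewrite /= !size_cat su => /eqP;
    by rewrite ?eqn_add2r ?eqn_add2l => /eqP.
have [Es Eu] : lead s = lead s' /\ lead u = lead u'.
  move/eqP: E; rewrite -Eg.
  by case: (g); rewrite /= eqseq_cat // => /andP[/eqP -> /eqP ->].
by rewrite Eg (IHs s') // (IHu u').
Qed.

End Decoding.

(** * Maxima and finiteness of components *)

Lemma exists_max (T : eqType) (r : rel T) (s : seq T) (x0 : T) : x0 \in s ->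
  {in s, reflexive r} -> {in s &, total r} -> {in s & &, transitive r} ->
  exists2 m, m \in s & {in s, forall x, r x m}.
Proof.
elim: s x0 => [|x s IHs] x0 // _ rr rto rtr.
have sub : {subset s <= x :: s} by move=> y ys; rewrite inE ys orbT.
have xx : x \in x :: s by rewrite mem_head.
case: s IHs rr rto rtr sub xx => [|y s] IHs rr rto rtr sub xx.
  by exists x => // z; rewrite inE => /eqP ->; apply: rr.
have [|||m ms mm] := IHs y (mem_head _ _).
- by move=> z /sub; apply: rr.
- by move=> z w /sub zs /sub ws; apply: rto.
- by move=> w z v /sub ws /sub zs /sub vs; apply: rtr.
have [xm|mx] := orP (rto x m xx (sub _ ms)).
  exists m => [|z]; first exact: sub.
  by rewrite inE => /predU1P[->|/mm].
exists x => // z; rewrite inE => /predU1P[->|zs]; first exact: rr.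
by apply: (rtr m) => //; [exact: sub|exact: sub|exact: mm].
Qed.

Section Enumeration.
Variable S : signature.

(** A finite list containing a whole component; counting in it the trees below a given one gives a
    termination measure for any [le]. *)
Fixpoint bounded_trees (d n : nat) : seq (tree S) :=
  [seq Leaf c j | c <- enum (colour S), j <- iota 0 n.+1] ++
  if d is d'.+1 then
    [seq Node h.1 h.2 u | h <- [seq (g, s) | g <- enum (gen S), s <- bounded_trees d' n],
       u <- bounded_trees d' n]
  else [::].

Lemma mem_bounded_trees d n (t : tree S) :
  (vertices t <= d)%N -> {in labels t, forall j, (j <= n)%N} ->
  t \in bounded_trees d n.
Proof.
elim: t d => [c j|g s IHs u IHu] d /= vt lt.
  have jn : (j <= n)%N by apply: lt; rewrite inE.
  suff jc : Leaf c j \in [seq Leaf c j | c <- enum (colour S), j <- iota 0 n.+1].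
    by case: d {vt} => *; rewrite /= mem_cat jc.
  by apply: allpairs_f; rewrite ?mem_enum // mem_iota.
case: d vt => // d vt; rewrite [bounded_trees _ _]/= mem_cat; apply/orP; right.
have st : s \in bounded_trees d n.
  apply: IHs => [|j js]; first by lia.
  by apply: lt; rewrite labels_node mem_cat js.
have ut : u \in bounded_trees d n.
  apply: IHu => [|j js]; first by lia.
  by apply: lt; rewrite labels_node mem_cat js orbT.
apply: (allpairs_f (fun h u => Node h.1 h.2 u) (x := (g, s))) => //.
by apply: allpairs_f; rewrite ?mem_enum.
Qed.

Lemma vertices_arity (t : tree S) : (vertices t).+1 = arity t.
Proof.
elim: t => //= g s IHs u IHu; rewrite /arity /= size_cat -/(arity s) -/(arity u).
by rewrite -IHs -IHu addSn addnS.
Qed.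

Lemma typed_bounded chi c (t : tree S) : typed chi c t ->
  t \in bounded_trees (size chi) (size chi).
Proof.
move=> tt; have [lt _] := typed_labels tt; apply: mem_bounded_trees.
  by rewrite -(typed_arity tt) -vertices_arity.
by move=> j; rewrite lt mem_iota; lia.
Qed.

End Enumeration.

Lemma count_lt (T : eqType) (a b : pred T) (s : seq T) x :
  subpred a b -> x \in s -> ~~ a x -> b x -> (count a s < count b s)%N.
Proof.
move=> ab xs ax bx; elim: s xs => //= y s IHs; rewrite inE.
have le := sub_count ab s; have yle : (a y <= b y)%N.
  by case ay : (a y) => //; rewrite (ab _ ay).
case/predU1P=> [<-|/IHs lt]; last by rewrite -addnS leq_add.
by rewrite (negbTE ax) bx add0n add1n ltnS.
Qed.

Lemma lexb_irr w : lexb w w = false.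
Proof.
elim: w => //= g w ->; rewrite andbF orbF.
by case: g.
Qed.

Lemma word_ltb_irr w : word_ltb w w = false.
Proof. by rewrite /word_ltb !ltnn !lexb_irr !andbF. Qed.

Lemma lower_irr t : ~ lower t t.
Proof. by case=> j [_ _]; rewrite word_ltb_irr. Qed.

Lemma lowerb_lower q P : perm_eq (labels P) (iota 1 3) -> lowerb q P -> lower q P.
Proof.
move=> pP /hasP[j jI /andP[/allP low lt]]; exists j; split=> //.
  by rewrite (perm_mem pP).
by move=> i; rewrite (perm_mem pP) => /low /implyP H /H /eqP.
Qed.

(** Every clause but homogeneity passes to the intersection; homogeneity is assumed since the family
    of ideals containing [G] could be empty. *)
Lemma generated_idealP (k : fieldType) (S : signature)
    (G : {malg k[tree S]} -> Prop) :
  (forall f, generated_ideal G f -> exists chi c, in_component chi c f) ->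
  operadic_ideal (generated_ideal G).
Proof.
move=> hom; split=> //.
- by move=> M MI _; apply: ideal0 MI.
- move=> chi c f g fc gc Mf Mg M MI GM.
  by apply: (idealD MI fc gc); [apply: Mf|apply: Mg].
- by move=> x f Mf M MI GM; apply: (idealZ MI); apply: Mf.
- move=> l omega chi c chi' c' f g fc gc lc sh fg M MI GM.
  apply: (ideal_compose MI fc gc lc sh).
  by case: fg => H; [left|right]; apply: H.
Qed.

(** * Reduction to normal trees and leading terms *)

Section Groebner.
Variables (k : fieldType) (rk : gen lp_sig -> nat).
Hypotheses (rk_ab : (rk Gb < rk Ga)%N) (rk_de : (rk Ge < rk Gd)%N).
Variable le : rel (tree lp_sig).
Hypotheses (le_adm : admissible_order le) (le_qm : extends_qm lp_is_x rk le).

Lemma typed_monomial chi c (t : tree lp_sig) : typed chi c t -> tree_monomial t.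
Proof. by case/and4P. Qed.

Lemma typed_good chi c (t : tree lp_sig) : typed chi c t -> good t.
Proof.
move=> tt; have [_ ut] := typed_labels tt.
by move: tt; rewrite typedE /good ut => /and4P[-> -> _ _].
Qed.

Lemma lower_le chi c t t' : typed chi c t -> typed chi c t' -> lower t' t -> le t' t.
Proof.
move=> tt tt' lo; apply: le_qm; rewrite ?(typed_monomial tt) ?(typed_monomial tt') //.
- exact: typed_monomial tt'.
- exact: typed_monomial tt.
- apply: lower_qm_lt => //; first by rewrite (typed_arity tt) (typed_arity tt').
  by rewrite (typed_arity tt); have [] := typed_labels tt.
Qed.

(** Induction on the number of trees of the component strictly below [t], to which [lower] relates
    through [le_qm]. *)
Lemma reduction chi c t : typed chi c t ->
  exists f : {malg k[tree lp_sig]},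
    eval_lin (@generic k) f = eval (@generic k) t /\
    {in msupp f, forall n, [/\ typed chi c n, normal n & le n t]}.
Proof.
pose below t x := [&& typed chi c x, le x t & x != t].
have [m] := ubnP (count (below t) (bounded_trees lp_sig (size chi) (size chi))).
elim: m t => // m IHm t; rewrite ltnS => cm tt.
have mt := typed_monomial tt.
case nt : (normal t).
  exists << t >>; split; first by rewrite /eval_lin mlinU.
  move=> n /(fsubsetP msuppU_le); rewrite inE => /eqP ->; split=> //.
  exact: (adm_refl le_adm).
have [l [El Hl]] := not_normal_rewrites (free_algebra k int) (typed_good tt) (negbT nt).
have {}Hl : {in l, forall p, exists f : {malg k[tree lp_sig]},
    eval_lin (@generic k) f = eval (@generic k) p.2 /\
    {in msupp f, forall n, [/\ typed chi c n, normal n & le n t]}}.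
  move=> p pl; have [[w i o _ p_] lo] := Hl p pl.
  have tp : typed chi c p.2.
    move: tt; rewrite !typedE w i o => /and4P[_ _ -> /=].
    exact: perm_trans.
  have lep := lower_le tt tp lo; have mp := typed_monomial tp.
  have ne : p.2 != t by apply/eqP => E; rewrite E in lo; apply: lower_irr lo.
  have [|//|f [Ef Hf]] := IHm p.2.
    apply: leq_trans cm; apply: (count_lt (x := p.2)).
    - move=> x /and3P[tx xp nxp]; have mx := typed_monomial tx.
      rewrite /below tx (adm_trans le_adm mp mx mt xp lep) /=.
      apply/eqP => E; case/eqP: ne; apply: (adm_anti le_adm) => //.
      by rewrite lep -E.
    - exact: typed_bounded tp.
    - by rewrite /below eqxx !andbF.
    - by rewrite /below tp lep ne.
  exists f; split=> // n nf; have [tn nn le_] := Hf n nf; split=> //.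
  exact: (adm_trans le_adm mp (typed_monomial tn) mt le_ lep).
rewrite (El (@generic k)).
elim: l {El} Hl => [|p l IHl] Hl.
  exists 0; split; last by move=> n; rewrite msupp0.
  by rewrite big_nil /eval_lin linear0.
have [f [Ef Hf]] := Hl p (mem_head _ _).
have [|g [Eg Hg]] := IHl; first by move=> q ql; apply: Hl; rewrite inE ql orbT.
exists ((-1) ^+ p.1 *: f + g); split.
  by rewrite big_cons /eval_lin linearD linearZ /= -Eg -Ef.
move=> n /(fsubsetP (msuppD_le _ _)); rewrite in_fsetU => /orP[|/Hg//].
by move/(fsubsetP (msuppZ_le _ _))/Hf.
Qed.

Lemma leading_term_not_normal (f : {malg k[tree lp_sig]}) t :
  lp_ideal f -> leading_term le f t -> ~~ normal t.
Proof.
move=> /(lp_ideal_kernel (free_algebra k int))[[chi [c fc]] f0] [tf tmax].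
apply/negP => nt; have tt := fc t tf; have mt := typed_monomial tt.
(* Every other term [s] of [f] is strictly below [t], hence so are the normal trees it reduces to,
   and [t] is not among them. *)
have [h [Eh Hh]] : exists h : {malg k[tree lp_sig]},
    eval_lin (@generic k) h =
      \sum_(s <- msupp f | s != t) f@_s *: eval (@generic k) s /\
    {in msupp h, forall n, [/\ typed chi c n, normal n & n != t]}.
  suff H (r : seq (tree lp_sig)) : {subset r <= msupp f} ->
      exists h : {malg k[tree lp_sig]}, eval_lin (@generic k) h =
        \sum_(s <- r | s != t) f@_s *: eval (@generic k) s /\
      {in msupp h, forall n, [/\ typed chi c n, normal n & n != t]}.
    exact: H.
  elim: r => [|s r IHr] sub.
    exists 0; split; last by move=> n; rewrite msupp0.
    by rewrite big_nil /eval_lin linear0.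
  have [|h [Eh Hh]] := IHr; first by move=> x xr; apply: sub; rewrite inE xr orbT.
  rewrite big_cons; case: eqVneq => [_|st]; first by exists h.
  have sf : s \in msupp f by apply: sub; rewrite mem_head.
  have ts := fc s sf; have ms := typed_monomial ts.
  have [g [Eg Hg]] := reduction ts.
  exists (f@_s *: g + h); split.
    by rewrite /eval_lin linearD linearZ /= -Eg -Eh.
  move=> n /(fsubsetP (msuppD_le _ _)); rewrite in_fsetU => /orP[|/Hh//].
  move/(fsubsetP (msuppZ_le _ _))/Hg => [tn nn ns]; split=> //.
  apply/eqP => E; case/eqP: st; apply: (adm_anti le_adm) => //.
  by rewrite tmax // -E.
(* [F] is a combination of normal trees with the same evaluation as [f], namely 0, yet its
   coefficient at [t] is still the one in [f]. *)
pose F := f@_t *: << t >> + h.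
have F0 : eval_lin (@generic k) F = 0.
  rewrite /eval_lin linearD linearZ /= mlinU [mlin _ h]Eh.
  have := f0 (@generic k); rewrite /eval_lin /mlin (bigD1_seq t) ?fset_uniq //.
have HF : {in msupp F, forall n, typed chi c n /\ normal n}.
  move=> n /(fsubsetP (msuppD_le _ _)); rewrite in_fsetU => /orP[|/Hh[]//].
  move/(fsubsetP (msuppZ_le _ _))/(fsubsetP msuppU_le).
  by rewrite inE => /eqP ->.
have Ft : F@_t = f@_t.
  rewrite /F mcoeffD mcoeffZ mcoeffUU mulr1.
  rewrite (mcoeff_outdom (g := h)) ?addr0 //; apply/negP => /Hh[_ _].
  by rewrite eqxx.
have ft0 : f@_t != 0 by rewrite mcoeff_neq0.
have tF : t \in (msupp F : seq _) by rewrite -mcoeff_neq0 Ft.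
have := @eval_independent k (msupp F) (fun s => F@_s) (fset_uniq _) _ _ F0 t tF.
rewrite Ft => H; case/eqP: ft0; apply: H.
  by move=> n /HF[/typed_good].
move=> n n' /HF[tn nn] /HF[tn' nn'].
by apply: lead_inj => //; apply: typed_good; [apply: tn|apply: tn'].
Qed.

Lemma relation_leading_term r P : r \in shuffle_relations -> is_lead r P ->
  leading_term le (signed_sum k r) P.
Proof.
move=> rr /and4P[ur pP /mapP[p pr EP] /allP rep].
have [chi [c rc]] := shuffle_relations_typed k rr.
have Pr : P \in msupp (signed_sum k r).
  by rewrite -mcoeff_neq0 EP (mcoeff_signed_sum k ur pr) signr_eq0.
split=> // s sr; have /mapP[q qr Eq] := msupp_signed_sum sr.
have := rep q qr; rewrite -Eq => /predU1P[->|].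
  exact/(adm_refl le_adm)/typed_monomial/(rc P Pr).
case/and5P=> _ _ _ _ /andP[_ lo].
by apply: (lower_le (rc P Pr) (rc s sr)); apply: lowerb_lower.
Qed.

End Groebner.

Local Close Scope ring_scope.

Theorem theorem4p10 (k : fieldType) (char0 : [pchar k]%R =i pred0)
    (rk : gen lp_sig -> nat) (rk_inj : injective rk)
    (rk_ab : rk Gb < rk Ga) (rk_de : rk Ge < rk Gd)
    (le : rel (tree lp_sig)) (le_adm : admissible_order le)
    (le_qm : extends_qm lp_is_x rk le) :
  groebner_basis le (@lp_shuffle_relations k) (@lp_ideal k) /\
  quadratic (@lp_shuffle_relations k).
Proof.
split; last exact: lp_quadratic.
(* The kernel of evaluation is an ideal containing the relations, so the homogeneity of its elements
   is inherited. *)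
have hom f : @lp_ideal k f -> exists chi c, in_component chi c f.
  by case/(lp_ideal_kernel (free_algebra k int)).
split=> // [|f Mf f0]; first exact: generated_idealP.
have [chi [c fc]] := hom f Mf.
have /fset0Pn[t0 t0f] : msupp f != fset0 by rewrite malg_msupp_eq0.
have mon s : s \in (msupp f : seq _) -> tree_monomial s.
  by move=> /fc; apply: typed_monomial.
have [|||t tf tmax] := exists_max (r := le) t0f.
- by move=> s /mon; apply: (adm_refl le_adm).
- by move=> s s' /mon ms /mon ms'; apply: (adm_total le_adm).
- by move=> s s' s'' /mon ms /mon ms' /mon ms''; apply: (adm_trans le_adm).
have lt : leading_term le f t by split.
have nt := leading_term_not_normal rk_ab rk_de le_adm le_qm Mf lt.
have [r [P [rr rP dP]]] := divides_lead (typed_good (fc t tf)) nt.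
exists t, (signed_sum k r), P; split=> //.
  by apply/lp_shuffle_relationsP; exists r.
exact: (relation_leading_term k rk_ab rk_de le_adm le_qm rr rP).
Qed.
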